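(* Let $G$ be a countably infinite amenable group with a Følner sequence $F=(F_N)_{N\in\mathbb{N}}$. (a) For every measure preserving system $(X,\mathcal{B},\mu,(T_g)_{g\in G})$ and every $B\in\mathcal{B}$ there exists a subset $A\subseteq G$ such that, for all $n\in\mathbb{N}$, $\varepsilon_1,\dots,\varepsilon_n\in\{0,1\}$ and $g_1,\dots,g_n\in G$, the density on the left below exists and $$d_F\left(\bigcap_{i=1}^n(g_iA)^{\varepsilon_i}\right)=\mu\left(\bigcap_{i=1}^n(T_{g_i}B)^{\varepsilon_i}\right).\qquad( * )$$ (b) Reciprocally, for any subset $A\subseteq G$ there is a measure preserving system $(X,\mathcal{B},\mu,(T_g)_{g\in G})$ and $B\in\mathcal{B}$ satisfying $( * )$ for all $n\in\mathbb{N}$, $\varepsilon_1,\dots,\varepsilon_n\in\{0,1\}$ and $g_1,\dots,g_n\in G$ such that the density on the left hand side of $( * )$ exists.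
   Context: A (left) Følner sequence in a countable group $G$ is a sequence $F=(F_N)_{N\in\mathbb{N}}$ of (nonempty) finite subsets of $G$ such that $\lim_{N\to\infty}\frac{|gF_N\Delta F_N|}{|F_N|}=0$ for all $g\in G$; $G$ is (left) amenable if it has a Følner sequence. For $E\subseteq G$, $d_F(E):=\lim_{N\to\infty}\frac{|E\cap F_N|}{|F_N|}$ when this limit exists. A measure preserving system $(X,\mathcal{B},\mu,(T_g)_{g\in G})$ is a probability space $(X,\mathcal{B},\mu)$ together with an action $(T_g)_{g\in G}$ of $G$ on $X$ by measure preserving maps (so $T_g\circ T_h=T_{gh}$). For $E\subseteq G$ write $E^1=E$, $E^0=G\setminus E$; for $C\subseteq X$ write $C^1=C$, $C^0=X\setminus C$. *)

(* Defs.v *)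
From HB Require Import structures.
From mathcomp Require Import all_boot all_order all_algebra finmap.
From mathcomp Require Import all_classical all_reals all_analysis.

Set Implicit Arguments.
Unset Strict Implicit.
Unset Printing Implicit Defensive.

Import Order.TTheory GRing.Theory Num.Theory.
Import numFieldNormedType.Exports.

Local Open Scope classical_set_scope.
Local Open Scope ring_scope.

Definition fset_translate (G : groupType) (g : G) (K : {fset G}) : {fset G} :=
  [fset (g * x)%g | x in K]%fset.

Definition fset_symdiff (G : choiceType) (K L : {fset G}) : {fset G} :=
  ((K `\` L) `|` (L `\` K))%fset.

Definition folner (R : realType) (G : groupType) (F : nat -> {fset G}) : Prop :=
  (forall N, F N != fset0) /\
  (forall g : G,
     (fun N => (#|` fset_symdiff (fset_translate g (F N)) (F N)|)%:R
               / (#|` F N|)%:R : R) @ \oo --> (0 : R)).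

Definition amenable (R : realType) (G : groupType) : Prop :=
  exists F : nat -> {fset G}, folner R F.

Definition folner_ratio (R : realType) (G : groupType) (F : nat -> {fset G})
    (E : set G) (N : nat) : R :=
  (#|` [fset x in F N | x \in E]%fset|)%:R / (#|` F N|)%:R.

Definition has_density (R : realType) (G : groupType) (F : nat -> {fset G})
    (E : set G) : Prop :=
  cvgn (folner_ratio R F E).

(* Meaningful only when [has_density R F E] holds. *)
Definition density (R : realType) (G : groupType) (F : nat -> {fset G})
    (E : set G) : R :=
  limn (folner_ratio R F E).

Definition measure_preserving (R : realType) (d : measure_display)
    (X : measurableType d) (mu : probability X R) (f : X -> X) : Prop :=
  measurable_fun [set: X] f /\
  (forall C : set X, measurable C -> mu (f @^-1` C) = mu C).

Definition measure_preserving_action (R : realType) (G : groupType)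
    (d : measure_display) (X : measurableType d) (mu : probability X R)
    (T : G -> X -> X) : Prop :=
  [/\ T 1%g = id,
      forall g h : G, T (g * h)%g = T g \o T h &
      forall g : G, measure_preserving mu (T g)].

(* [true] and [false] stand for the exponents 1 and 0. *)
Definition set_pow (X : Type) (C : set X) (e : bool) : set X :=
  if e then C else ~` C.

Definition translate_cylinder (G : groupType) (A : set G) (n : nat)
    (e : 'I_n -> bool) (g : 'I_n -> G) : set G :=
  \bigcap_(i in [set: 'I_n]) set_pow [set (g i * x)%g | x in A] (e i).

(* For a measure preserving action the direct image [T g @` B] is measurable:
   it is the preimage of [B] under [T g^-1]. *)
Definition action_cylinder (G : groupType) (X : Type) (T : G -> X -> X)
    (B : set X) (n : nat) (e : 'I_n -> bool) (g : 'I_n -> G) : set X :=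
  \bigcap_(i in [set: 'I_n]) set_pow (T (g i) @` B) (e i).

(* Main.v *)
Require Import Defs.
From mathcomp Require Import all_boot all_order all_algebra finmap.
From mathcomp Require Import all_classical all_reals all_analysis.
From mathcomp Require Import measurable_realfun.
From mathcomp Require Import ring lra.

(** Part (a).  Listing the cylinders, we look for a configuration [x : G -> bool]
    along which countably many centred local statistics [f i x y] have averages
    over [F N] tending to [0].  The system enters only through sampling: since
    the orbit of a [mu]-random point has centred statistics of mean zero, every
    finite linear combination of them is nonpositive at some configuration.

    A finite set [U] can be cut greedily into pieces [S c /\ U], [S] a Folner
    set, losing few points near the cuts (average over [c]).  Filling the pieces
    one at a time with a sample having nonpositive inner product with the vector
    of partial sums over all the windows [E h], the squared sums over these
    windows only add up, so that some configuration on [U] has small energy: its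
    windows are almost all nearly balanced.  Hence a configuration nearly
    minimizing the total energy over a large finite set is balanced on every
    invariant subset [U], since otherwise one could modify it on [U].  Such
    configurations of better and better quality are glued along an exhausting
    sequence of finite sets, each nearly minimizing its perimeter among the
    supersets of a given set: by the same exchange argument, its boundary meets
    every Folner set in few points, whatever its size.

    Part (b).  Limits of [|E /\ F N| / |F N|] along an ultrafilter give an
    invariant finitely additive mean on [G].  The probability on [G -> bool]
    with the corresponding cylinder masses is the image of the uniform measure
    on [0, 1] under a digit expansion, a word being represented by an interval
    whose length is the mean of its cylinder. *)

Set Implicit Arguments.
Unset Strict Implicit.
Unset Printing Implicit Defensive.

Import Order.TTheory GRing.Theory Num.Theory.
Import numFieldNormedType.Exports.

Local Open Scope classical_set_scope.
Local Open Scope ring_scope.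

(** * Cutting a finite set into tiles *)

Lemma sum_le_exists (R : realDomainType) (T : eqType) (s : seq T) (a b : T -> R) :
  s != [::] -> \sum_(c <- s) a c <= \sum_(c <- s) b c ->
  exists2 c, c \in s & a c <= b c.
Proof.
elim: s => // x s IHs _; rewrite !big_cons.
have [le_x|lt_x] := leP (a x) (b x); first by exists x; rewrite ?mem_head.
have [-> | s0 le_s] := eqVneq s [::].
  by rewrite !big_nil !addr0 leNgt lt_x.
have [|c cs le_c] := IHs s0; first by lra.
by exists c => //; rewrite inE cs orbT.
Qed.

Lemma big_ind_seq (R : pzRingType) (T : Type) (s : seq T) (P : pred T) (phi : T -> R) :
  \sum_(h <- s) (P h)%:R * phi h = \sum_(h <- s | P h) phi h.
Proof.
rewrite [RHS]big_mkcond; apply: eq_bigr => h _.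
by case: (P h); rewrite ?mul1r ?mul0r.
Qed.

Lemma sum1_fset (R : pzRingType) (T : choiceType) (U : {fset T}) :
  \sum_(y <- U) (1 : R) = #|` U|%:R.
Proof. by rewrite -sum1_size natr_sum. Qed.

Lemma reindex_fset (R : pzRingType) (T : choiceType) (A B : {fset T})
    (f f' : T -> T) (phi : T -> R) : cancel f f' -> cancel f' f ->
  \sum_(h <- A) (f h \in B)%:R * phi (f h) = \sum_(z <- B) (f' z \in A)%:R * phi z.
Proof.
move=> fK f'K; rewrite !big_ind_seq.
transitivity (\sum_(z <- [seq f h | h <- [seq h <- A | f h \in B]]) phi z).
  by rewrite big_map big_filter.
rewrite -[RHS]big_filter; apply: perm_big; apply: uniq_perm.
- by rewrite (map_inj_uniq (can_inj fK)) filter_uniq.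
- by rewrite filter_uniq.
move=> z; rewrite mem_filter; apply/mapP/andP => [[h]|[zA zB]].
  by rewrite mem_filter => /andP[fhB hA] ->; rewrite fK.
by exists (f' z); rewrite ?mem_filter f'K ?zB.
Qed.

Section Combinatorics.
Context {R : realType} {G : groupType}.
Implicit Types (U S F E H D Y : {fset G}) (L : seq G) (g : G).

(** The boundary of [U] in the direction [g], as a real number. Most error terms of part (a) are
    expressed through it or through [cut]. *)
Definition exits U g : R := \sum_(y <- U) ((g * y)%g \notin U)%:R.

Lemma ind_ge0 (b : bool) : 0 <= b%:R :> R.
Proof. exact: ler0n. Qed.

Lemma ind_le1 (b : bool) : b%:R <= 1 :> R.
Proof. by rewrite lern1 leq_b1. Qed.

Lemma exits_ge0 U g : 0 <= exits U g.
Proof. by apply: sumr_ge0 => y _. Qed.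

Lemma divl_cancel g : cancel (fun y => g * y^-1)%g (fun y => y^-1 * g)%g.
Proof. by move=> y; rewrite invgM invgK mulgVK. Qed.

Lemma divl_cancel' g : cancel (fun y => y^-1 * g)%g (fun y => g * y^-1)%g.
Proof. by move=> y; rewrite invgM invgK mulVKg. Qed.

Lemma sum_ind_le (A B : {fset G}) (f f' : G -> G) (phi : G -> R) :
  cancel f f' -> cancel f' f -> (forall z, 0 <= phi z) ->
  \sum_(h <- A) (f h \in B)%:R * phi (f h) <= \sum_(z <- B) phi z.
Proof.
move=> fK f'K phi0; rewrite (reindex_fset _ _ _ fK f'K).
by apply: ler_sum => z _; rewrite ler_piMl// ind_le1.
Qed.

Lemma card_tile_le U S c :
  #|` [fset y in U | (y * c^-1)%g \in S]%fset|%:R <= #|` S|%:R :> R.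
Proof.
rewrite -!sum1_fset big_fset /= -big_ind_seq.
exact: (sum_ind_le (phi := fun=> 1) _ _ (mulgVK c) (mulgK c)).
Qed.

(** One step of the greedy cutting. The number of separated pairs is controlled by the size of the
    tile removed, not by that of [U], so that the losses of successive cuts add up to a multiple of
    the size of the initial set. *)
Lemma tile_exists S U L : U != fset0 -> S != fset0 ->
  exists c, let t := [fset y in U | (y * c^-1)%g \in S]%fset in
  t != fset0 /\
  #|` S|%:R * (\sum_(l <- L) \sum_(y <- U)
     (((l * y)%g \in U) && (((l * y)%g \in t) != (y \in t)))%:R)
   <= (\sum_(l <- L) (exits S l + exits S l^-1)) * #|` t|%:R.
Proof.
move=> U0 S0.
pose C := [fset (s^-1 * y)%g | s in S, y in U]%fset.
pose tile c := [fset y in U | (y * c^-1)%g \in S]%fset.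
pose B c : R := \sum_(l <- L) \sum_(y <- U)
     (((l * y)%g \in U) && (((l * y)%g \in tile c) != (y \in tile c)))%:R.
pose k : R := \sum_(l <- L) (exits S l + exits S l^-1).
(* Such a [c] exists by averaging: each [y] lies in exactly [#|S|] translates of
   [S], and few of them separate [y] from [l * y]. *)
have [c cC le_c] : exists2 c, c \in enum_fset C &
    #|` S|%:R * B c <= k * #|` tile c|%:R.
  apply: sum_le_exists.
    have /fset0Pn[s sS] := S0; have /fset0Pn[y yU] := U0.
    have : (s^-1 * y)%g \in enum_fset C by apply/imfset2P; exists s => //; exists y.
    by case: (enum_fset C).
  have -> : \sum_(c <- C) (k * #|` tile c|%:R) = k * (#|` S|%:R * #|` U|%:R).
    rewrite -mulr_sumr; congr (_ * _).
    under eq_bigr do rewrite -sum1_fset big_fset /= -big_ind_seq.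
    rewrite exchange_big /= -[X in _ * X]sum1_fset mulr_sumr.
    rewrite [RHS]big_seq [LHS]big_seq; apply: eq_bigr => y yU.
    rewrite mulr1 (reindex_fset _ _ (fun _ => 1) (divl_cancel y) (divl_cancel' y)).
    rewrite -sum1_fset [RHS]big_seq [LHS]big_seq; apply: eq_bigr => s sS.
    rewrite mulr1 (_ : _ \in C)//.
    by apply/imfset2P; exists s => //; exists y.
  rewrite -mulr_sumr mulrCA ler_wpM2l//.
  rewrite /B exchange_big /= mulr_suml; apply: ler_sum => l _.
  rewrite exchange_big /= -sum1_fset mulr_sumr.
  rewrite big_seq [leRHS]big_seq; apply: ler_sum => y yU; rewrite mulr1.
  (* If a tile separates [y] from [l * y], then [y * c^-1] leaves [S] under [l], or [l * y * c^-1]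
     leaves it under [l^-1]. Either point determines [c], so the sums over [c] are at most
     boundaries of [S]. *)
  apply: (@le_trans _ _ (\sum_(c <- C)
      (((y * c^-1)%g \in S)%:R * ((l * (y * c^-1))%g \notin S)%:R +
      ((l * y * c^-1)%g \in S)%:R * ((l^-1 * (l * y * c^-1))%g \notin S)%:R))).
    apply: ler_sum => c _; rewrite !inE yU /= -!mulgA mulKg.
    by case: (_ \in U); case: (_ \in S); case: (_ \in S); rewrite /=; lra.
  rewrite big_split /=; apply: lerD.
  - exact: (sum_ind_le (phi := fun s => ((l * s)%g \notin S)%:R) _ _
      (divl_cancel y) (divl_cancel' y)).
  - exact: (sum_ind_le (phi := fun s => ((l^-1 * s)%g \notin S)%:R) _ _
      (divl_cancel (l * y)%g) (divl_cancel' (l * y)%g)).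
exists c; split => //.
have /imfset2P[s sS [y yU ce]] := cC; apply/fset0Pn; exists y.
by rewrite !inE /= yU ce invgM invgK mulgA mulgV mul1g.
Qed.

End Combinatorics.

Lemma sum_sub (R : pzRingType) (T : choiceType) (A B : {fset T}) (phi : T -> R) :
  (A `<=` B)%fset -> \sum_(y <- A) phi y = \sum_(y <- B) (y \in A)%:R * phi y.
Proof.
move=> AB; rewrite -(@big_fset_incl _ _ _ _ A B) //; last first.
  by move=> x _ /negbTE ->; rewrite mul0r.
by rewrite big_seq [RHS]big_seq; apply: eq_bigr => y ->; rewrite mul1r.
Qed.

Lemma card_sub (R : pzRingType) (T : choiceType) (A B : {fset T}) :
  (A `<=` B)%fset -> #|` A|%:R = \sum_(y <- B) (y \in A)%:R :> R.
Proof.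
move=> AB; rewrite -sum1_fset (sum_sub _ AB).
by apply: eq_bigr => y _; rewrite mulr1.
Qed.

Lemma not_all_le (R : numDomainType) (T : eqType) (s : seq T) (P : pred T) :
  (~~ all P s)%:R <= \sum_(l <- s) (~~ P l)%:R :> R.
Proof.
elim: s => [|l s IHs]; first by rewrite big_nil.
rewrite big_cons /=; case: (P l) => /=; first by rewrite add0r.
by rewrite lerDl sumr_ge0.
Qed.

(** * Configurations of small energy *)

(** The infimum need not be attained; being within 1 of it suffices because Folner sets become
    large. *)
Lemma near_min (R : realType) (T : Type) (t0 : T) (phi : T -> R) :
  (forall x, 0 <= phi x) -> exists x, forall x', phi x <= phi x' + 1.
Proof.
move=> phi0; pose A := [set phi x | x in [set: T]]%classic.
have hA : has_inf A.
  by split; [exists (phi t0), t0 | exists 0 => _ [x _ <-]].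
have [_ [x _ <-] ltx] := inf_adherent (@ltr01 R) hA.
exists x => x'; rewrite ltW// (lt_le_trans ltx)// lerD2r.
by apply: ge_inf; [exact: hA.2 | exists x'].
Qed.

Section Energy.
Context {R : realType} {G : groupType}.
Implicit Types (U S F E H D Y : {fset G}) (g : G).
Variables (k : nat) (f : nat -> (G -> bool) -> G -> R) (L : seq G).
Hypothesis f_le1 : forall i x y, `|f i x y| <= 1.
Hypothesis f_loc : forall i x x' y, (i < k)%N ->
  (forall l, l \in L -> x (l * y)%g = x' (l * y)%g) -> f i x y = f i x' y.
Hypothesis f_sample : forall (Z : seq G) (a : nat -> G -> R),
  exists x, \sum_(i < k) \sum_(y <- Z) a i y * f i x y <= 0.

(** The relative boundary of the tile shape: the share of points given up when cutting by [S]. *)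
Definition tile_loss S : R := (\sum_(l <- L) (exits S l + exits S l^-1)) / #|` S|%:R.

(** Induction on the size of [U], one tile at a time. [Y] collects the points whose window stays in
    their own tile, so that filling the other tiles does not affect their statistics. The bound is
    linear in the size of [U] since the cross terms between tiles are nonpositive. *)
Lemma balanced_sample S E H : S != fset0 -> forall U, exists x Y,
  [/\ (Y `<=` U)%fset,
      forall y l, y \in Y -> l \in L -> (l * y)%g \in U,
      #|` U|%:R - #|` Y|%:R <= \sum_(l <- L) exits U l + tile_loss S * #|` U|%:R &
      \sum_(h <- H) \sum_(i < k)
         (\sum_(y <- Y) ((y * h^-1)%g \in E)%:R * f i x y) ^+ 2
       <= k%:R * #|` S|%:R * #|` E|%:R * #|` U|%:R].
Proof.
move=> S0 U; have [n] := ubnP #|` U|; elim: n U => // n IHn U.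
have [-> _|U0 ltUn] := eqVneq U fset0.
  exists (fun=> false), fset0; split => //.
  - rewrite !cardfs0 mulr0 addr0 subrr sumr_ge0// => l _; exact: exits_ge0.
  - rewrite cardfs0 mulr0 big1// => h _; rewrite big1// => i _.
    by rewrite big_seq_fset0 expr0n.
have [c [t0 le_t]] := @tile_exists R G S U L U0 S0.
set t := [fset y in U | (y * c^-1)%g \in S]%fset in t0 le_t.
have tU : (t `<=` U)%fset by apply/fsubsetP => y; rewrite !inE => /andP[].
have tS : #|` t|%:R <= #|` S|%:R :> R by exact: card_tile_le.
clearbody t.
pose U' := (U `\` t)%fset.
have U'U : (U' `<=` U)%fset by exact: fsubsetDl.
have inU' y : (y \in U') = (y \notin t) && (y \in U) by rewrite inE.
have cardU : #|` U|%:R = #|` U'|%:R + #|` t|%:R :> R.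
  rewrite (card_sub _ U'U) (card_sub _ tU) -sum1_fset -big_split/=.
  rewrite big_seq [RHS]big_seq; apply: eq_bigr => y yU.
  by rewrite inU' yU; case: (y \in t); rewrite /= ?add0r ?addr0.
have [|x2 [Y' [Y'U LY' cardY' enY']]] := IHn U'.
  rewrite ltnS in ltUn; apply: leq_trans ltUn.
  by rewrite -(ltr_nat R) cardU ltrDl ltr0n cardfs_gt0.
pose Z := [fset y in t | all (fun l => (l * y)%g \in t) L]%fset.
have Zt : (Z `<=` t)%fset by apply/fsubsetP => y; rewrite !inE => /andP[].
pose V h (i : nat) := \sum_(y <- Y') ((y * h^-1)%g \in E)%:R * f i x2 y.
(* The sample filling the new tile is chosen so that its vector [W] of window
   sums has a nonpositive inner product with the vector [V] of the other tiles. *)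
have [x1 sx1] := f_sample Z
  (fun i y => \sum_(h <- H) V h i * ((y * h^-1)%g \in E)%:R).
pose W h (i : nat) := \sum_(y <- Z) ((y * h^-1)%g \in E)%:R * f i x1 y.
pose x y := if y \in t then x1 y else x2 y.
pose Y := (Y' `|` Z)%fset.
have YU : (Y `<=` U)%fset.
  by rewrite fsubUset (fsubset_trans Y'U U'U) (fsubset_trans Zt tU).
have sumY (phi : G -> R) : \sum_(y <- Y) phi y = \sum_(y <- Y') phi y + \sum_(y <- Z) phi y.
  rewrite (sum_sub _ YU) (sum_sub _ (fsubset_trans Y'U U'U)).
  rewrite (sum_sub _ (fsubset_trans Zt tU)) -big_split/=; apply: eq_bigr => y _.
  rewrite -mulrDl; congr (_ * _); rewrite inE.
  have [/(fsubsetP Y'U)|] := boolP (y \in Y') => /=; last by rewrite add0r.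
  rewrite inU' => /andP[yt _]; rewrite (_ : y \in Z = false) ?addr0//.
  by apply: contraNF yt; exact: (fsubsetP Zt).
exists x, Y; split => //.
- move=> y l; rewrite in_fsetU => /orP[yY' lL|]; first exact/(fsubsetP U'U)/LY'.
  by rewrite !inE => /andP[_ /allP yL] /yL lt; apply: (fsubsetP tU).
- have -> : #|` Y|%:R = #|` Y'|%:R + #|` Z|%:R :> R by rewrite -!sum1_fset sumY.
  rewrite cardU.
  have le1 : #|` t|%:R - #|` Z|%:R <= \sum_(l <- L) \sum_(y <- t) ((l * y)%g \notin t)%:R :> R.
    rewrite (card_sub _ Zt) -sum1_fset -sumrB exchange_big /=.
    rewrite big_seq [leRHS]big_seq; apply: ler_sum => y yt.
    rewrite (le_trans _ (not_all_le _ _ _))// !inE yt /=.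
    by case: all => /=; lra.
  (* A pair [y], [l * y] that leaves [U'] or [t] either leaves [U] or is separated by the cut. *)
  have le2 : \sum_(l <- L) exits U' l + \sum_(l <- L) \sum_(y <- t) ((l * y)%g \notin t)%:R
     <= \sum_(l <- L) exits U l + \sum_(l <- L) \sum_(y <- U)
     (((l * y)%g \in U) && (((l * y)%g \in t) != (y \in t)))%:R :> R.
    rewrite -!big_split /=; apply: ler_sum => l _.
    rewrite /exits (sum_sub _ U'U) (sum_sub _ tU) -!big_split/=.
    rewrite big_seq [leRHS]big_seq; apply: ler_sum => y yU.
    rewrite !inU' yU.
    have := fsubsetP tU (l * y)%g.
    case: ((l * y)%g \in t) => [/(_ isT) ->|_]; case: (y \in t);
      rewrite /= ?mul0r ?mul1r ?addr0 ?add0r //;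
      case: (_ \in U); rewrite /= ?addr0 ?add0r //.

  have le3 : \sum_(l <- L) \sum_(y <- U)
     (((l * y)%g \in U) && (((l * y)%g \in t) != (y \in t)))%:R <= tile_loss S * #|` t|%:R :> R.
    by rewrite /tile_loss mulrAC ler_pdivlMr ?ltr0n ?cardfs_gt0// [leLHS]mulrC.
  rewrite mulrDr; lra.
have fY' i y : (i < k)%N -> y \in Y' -> f i x y = f i x2 y.
  move=> ik yY'; apply: f_loc => // l /(LY' _ _ yY'); rewrite inU' => /andP[lt _].
  by rewrite /x (negbTE lt).
have fZ i y : (i < k)%N -> y \in Z -> f i x y = f i x1 y.
  move=> ik; rewrite !inE => /andP[_ /allP lt]; apply: f_loc => // l /lt.
  by rewrite /x => ->.
have -> : \sum_(h <- H) \sum_(i < k)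
         (\sum_(y <- Y) ((y * h^-1)%g \in E)%:R * f i x y) ^+ 2 =
   \sum_(h <- H) \sum_(i < k) (V h i) ^+ 2 +
   2 * (\sum_(h <- H) \sum_(i < k) V h i * W h i) +
   \sum_(h <- H) \sum_(i < k) (W h i) ^+ 2.
  rewrite mulr_sumr -!big_split /=; apply: eq_bigr => h _.
  rewrite mulr_sumr -!big_split /=; apply: eq_bigr => i _.
  rewrite sumY (_ : _ + _ = V h i + W h i); first by ring.
  congr (_ + _).
    by rewrite /V big_seq [RHS]big_seq; apply: eq_bigr => y yY; rewrite fY'.
  by rewrite /W big_seq [RHS]big_seq; apply: eq_bigr => y yY; rewrite fZ.
have le4 : \sum_(h <- H) \sum_(i < k) V h i * W h i <= 0.
  apply: le_trans sx1; rewrite exchange_big /= le_eqVlt; apply/orP; left; apply/eqP.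
  apply: eq_bigr => i _; rewrite /W.
  under eq_bigr do rewrite mulr_sumr.
  rewrite exchange_big /=; apply: eq_bigr => y _.
  by rewrite mulr_suml; apply: eq_bigr => h _; rewrite mulrA.
have le5 : \sum_(h <- H) \sum_(i < k) (W h i) ^+ 2 <=
    k%:R * #|` S|%:R * #|` E|%:R * #|` t|%:R.
  (* [m h] counts the points of [Z] in the window [E * h]. It bounds [W h i] and is at most the size
     of [S]; by double counting, its sum over [h] is at most the product of the sizes of [E] and
     [Z]. *)
  pose m h : R := \sum_(y <- Z) ((y * h^-1)%g \in E)%:R.
  have m_ge0 h : 0 <= m h by exact: sumr_ge0.
  have m_le h : m h <= #|` S|%:R.
    apply: le_trans tS; apply: (@le_trans _ _ #|` Z|%:R).
      by rewrite -sum1_fset; apply: ler_sum => y _; exact: ind_le1.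
    by rewrite ler_nat fsubset_leq_card.
  have W_le h i : (W h i) ^+ 2 <= #|` S|%:R * m h.
    have aW : `|W h i| <= m h.
      apply: le_trans (ler_norm_sum _ _ _) _; apply: ler_sum => y _.
      by rewrite normrM ger0_norm// ler_piMr.
    rewrite -real_normK ?num_real//; apply: (@le_trans _ _ (m h ^+ 2)).
      by rewrite ler_sqr ?nnegrE.
    by rewrite expr2 ler_wpM2r.
  apply: (@le_trans _ _ (\sum_(h <- H) k%:R * (#|` S|%:R * m h))).
    apply: ler_sum => h _.
    apply: (@le_trans _ _ (\sum_(i < k) #|` S|%:R * m h)).
      by apply: ler_sum => i _.
    by rewrite sumr_const card_ord -[(_ * m h) *+ k]mulr_natl.
  rewrite -!mulr_sumr -!mulrA ler_wpM2l// ler_wpM2l//.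
  rewrite /m exchange_big /=.
  apply: (@le_trans _ _ (\sum_(y <- Z) #|` E|%:R)).
    apply: ler_sum => y _; rewrite -sum1_fset.
    have := @sum_ind_le R G H E _ _ (fun=> 1) (divl_cancel y) (divl_cancel' y) (fun=> ler01).
    by apply: le_trans; apply: ler_sum => h _; rewrite mulr1.
  have -> : \sum_(y <- Z) #|` E|%:R = #|` E|%:R * #|` Z|%:R :> R.
    by rewrite -[#|` Z|%:R]sum1_fset mulr_sumr; apply: eq_bigr => y _; rewrite mulr1.
  by rewrite ler_wpM2l// ler_nat fsubset_leq_card.
rewrite cardU mulrDr; lra.
Qed.

Let energy E (x : G -> bool) h : R := \sum_(i < k) (\sum_(e <- E) f i x (e * h)%g) ^+ 2.

Lemma sum_f_le E i x h : `|\sum_(e <- E) f i x (e * h)%g| <= #|` E|%:R.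
Proof.
by rewrite -sum1_fset (le_trans (ler_norm_sum _ _ _))// ler_sum.
Qed.

Lemma energy_le E x h : energy E x h <= k%:R * #|` E|%:R ^+ 2.
Proof.
apply: (@le_trans _ _ (\sum_(i < k) #|` E|%:R ^+ 2)).
  apply: ler_sum => i _; rewrite -real_normK ?num_real//.
  by rewrite ler_sqr ?nnegrE ?sum_f_le.
by rewrite sumr_const card_ord -[(_ ^+ 2) *+ k]mulr_natl.
Qed.

Lemma energy_ge0 E x h : 0 <= energy E x h.
Proof. by apply: sumr_ge0 => i _; exact: sqr_ge0. Qed.

(** One [x] serves all subsets [F] of [Q]. The terms of the bound are, in order, the slack of the
    near minimizer, the energy of the balanced sample on [F], the window points where the sample is
    not controlled, and the windows based outside [F] that feel a change on [F]. The factors 2 come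
    from squaring a sum of two terms. *)
Lemma energy_near_minimizer S E Q : S != fset0 -> exists x, forall F, (F `<=` Q)%fset ->
  \sum_(h <- F) \sum_(i < k) (\sum_(e <- E) f i x (e * h)%g) ^+ 2 <=
  1 + 2 * (k%:R * #|` S|%:R * #|` E|%:R * #|` F|%:R) +
  2 * (k%:R * #|` E|%:R * (\sum_(e <- E) exits F e +
     #|` E|%:R * (\sum_(l <- L) exits F l + tile_loss S * #|` F|%:R))) +
  k%:R * #|` E|%:R ^+ 2 * \sum_(l <- L) \sum_(e <- E) exits F (l * e)^-1.
Proof.
move=> S0.
have [x x_min] : exists x, forall x',
    \sum_(h <- Q) energy E x h <= \sum_(h <- Q) energy E x' h + 1.
  apply: (near_min (fun=> false)) => x.
  by apply: sumr_ge0 => h _; exact: energy_ge0.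
exists x => F FQ; rewrite -/(energy E x _).
have [x1 [Y [YF LY cardY enY]]] := @balanced_sample S E Q S0 F.
(* Exchange argument: [x] is compared with its modification on [F]. *)
pose x' y := if y \in F then x1 y else x y.
pose touch h : R := \sum_(l <- L) \sum_(e <- E) ((l * e * h)%g \in F)%:R.
have touch_ge0 h : 0 <= touch h by apply: sumr_ge0 => l _; apply: sumr_ge0.
(* Outside [F] the two energies at [h] can differ only if some [l * e * h] lies in [F]; then
   [touch h] is at least 1 and the trivial bound on the energy is used. *)
have leF h : (h \in F)%:R * energy E x h <=
    energy E x h - energy E x' h + (h \in F)%:R * energy E x' h +
    k%:R * #|` E|%:R ^+ 2 * ((h \notin F)%:R * touch h).
  have [hF|hF] /= := boolP (h \in F); first by rewrite mul0r mulr0; lra.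
  rewrite !mul0r mul1r addr0 addrAC subr_ge0.
  have [touched|untouched] := boolP (has (fun l => has (fun e => (l * e * h)%g \in F) E) L).
    rewrite (le_trans (energy_le _ _ _))// ler_wpDl ?energy_ge0// ler_peMr ?mulr_ge0//.
    have [l lL /hasP[e eE leF]] := hasP touched.
    rewrite /touch (big_rem _ lL) /= (big_rem _ eE)/= leF -addrA lerDl.
    by rewrite addr_ge0// sumr_ge0// => ? _; rewrite sumr_ge0.
  rewrite ler_wpDr ?mulr_ge0//.
  rewrite le_eqVlt; apply/orP; left; apply/eqP; apply: eq_bigr => i _; congr (_ ^+ 2).
  rewrite big_seq [RHS]big_seq; apply: eq_bigr => e eE; apply: f_loc => // l lL.
  rewrite /x' ifN// mulgA; apply: contra untouched => leF.
  by apply/hasP; exists l => //; apply/hasP; exists e.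
have le1 : \sum_(h <- F) energy E x h <= 1 + \sum_(h <- F) energy E x' h +
    k%:R * #|` E|%:R ^+ 2 * \sum_(h <- Q) ((h \notin F)%:R * touch h).
  rewrite !(sum_sub _ FQ) mulr_sumr.
  have := @ler_sum R _ Q xpredT _ _ (fun h _ => leF h).
  rewrite !big_split /= sumrN; have := x_min x'; lra.
have le2 : \sum_(h <- Q) ((h \notin F)%:R * touch h) <=
    \sum_(l <- L) \sum_(e <- E) exits F (l * e)^-1.
  under eq_bigr do rewrite mulr_sumr.
  rewrite exchange_big /=; apply: ler_sum => l _.
  under eq_bigr do rewrite mulr_sumr.
  rewrite exchange_big /=; apply: ler_sum => e _.
  have := @sum_ind_le R G Q F _ _ (fun z => (((l * e)^-1 * z)%g \notin F)%:R)
    (mulKg (l * e)%g) (mulVKg (l * e)%g) (fun=> ind_ge0 _).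
  by apply: le_trans; apply: ler_sum => h _; rewrite mulKg mulrC.
have fY i y : (i < k)%N -> y \in Y -> f i x' y = f i x1 y.
  by move=> ik yY; apply: f_loc => // l lL; rewrite /x' LY.
pose V h (i : nat) := \sum_(y <- Y) ((y * h^-1)%g \in E)%:R * f i x1 y.
(* Outside [Y] the statistics are bounded only by [f_le1], so such points are merely counted. *)
pose m h : R := \sum_(e <- E) ((e * h)%g \notin Y)%:R.
have m_ge0 h : 0 <= m h by exact: sumr_ge0.
have m_le h : m h <= #|` E|%:R.
  by rewrite -sum1_fset; apply: ler_sum => e _; exact: ind_le1.
have le3 h : energy E x' h <= 2 * \sum_(i < k) V h i ^+ 2 + 2 * (k%:R * (#|` E|%:R * m h)).
  apply: (@le_trans _ _ (\sum_(i < k) (2 * V h i ^+ 2 + 2 * (#|` E|%:R * m h)))); last first.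
    rewrite big_split /= -mulr_sumr lerD2l sumr_const card_ord.
    by rewrite -[(_ * _) *+ k]mulr_natl; lra.
  apply: ler_sum => i _.
  have -> : \sum_(e <- E) f i x' (e * h)%g =
      V h i + \sum_(e <- E) ((e * h)%g \notin Y)%:R * f i x' (e * h)%g.
    rewrite /V -(reindex_fset E Y (fun y => f i x1 y) (mulgK h) (mulgVK h)).
    rewrite -big_split /=; apply: eq_bigr => e _.
    have [eY|_] /= := boolP (_ \in Y); last by rewrite mul0r mul1r add0r.
    by rewrite mul1r mul0r addr0 fY.
  set W := \sum_(e <- E) _.
  have W_le : `|W| <= m h.
    apply: le_trans (ler_norm_sum _ _ _) _; apply: ler_sum => e _.
    by rewrite normrM ger0_norm// ler_piMr.
  have : W ^+ 2 <= #|` E|%:R * m h.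
    rewrite -real_normK ?num_real//; apply: (@le_trans _ _ (m h ^+ 2)).
      by rewrite ler_sqr ?nnegrE.
    by rewrite expr2 ler_wpM2r.
  have := sqr_ge0 (V h i - W); rewrite sqrrB sqrrD; lra.
have le4 : \sum_(h <- F) m h <= \sum_(e <- E) exits F e +
     #|` E|%:R * (\sum_(l <- L) exits F l + tile_loss S * #|` F|%:R).
  apply: (@le_trans _ _ (\sum_(e <- E) (exits F e + (#|` F|%:R - #|` Y|%:R)))); last first.
    rewrite big_split /= lerD2l -[#|` E|%:R]sum1_fset mulr_suml; apply: ler_sum => e _.
    by rewrite mul1r.
  rewrite /m exchange_big /=; apply: ler_sum => e _.
  apply: (@le_trans _ _ (exits F e + \sum_(h <- F) ((e * h)%g \in F)%:R * ((e * h)%g \notin Y)%:R)).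
    rewrite /exits -big_split/=; apply: ler_sum => h _.
    by case: (_ \in F); case: (_ \in Y) => /=; lra.
  rewrite lerD2l (card_sub _ YF) -sum1_fset -sumrB.
  have := @sum_ind_le R G F F _ _ (fun z => (z \notin Y)%:R)
    (mulKg e) (mulVKg e) (fun=> ind_ge0 _).
  move=> /le_trans; apply; apply: ler_sum => z _.
  by case: (_ \in Y) => /=; lra.
have le5 : \sum_(h <- F) \sum_(i < k) V h i ^+ 2 <=
    k%:R * #|` S|%:R * #|` E|%:R * #|` F|%:R.
  apply: le_trans enY; rewrite (sum_sub _ FQ); apply: ler_sum => h _.
  by rewrite ler_piMl ?ind_le1// sumr_ge0// => i _; exact: sqr_ge0.
have le6 : \sum_(h <- F) energy E x' h <= 2 * (\sum_(h <- F) \sum_(i < k) V h i ^+ 2) +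
    2 * (k%:R * #|` E|%:R * \sum_(h <- F) m h).
  rewrite !mulr_sumr -big_split /=; apply: ler_sum => h _.
  by have := le3 h; rewrite !mulrA.
have {}le2 := ler_wpM2l (mulr_ge0 (ler0n R k) (sqr_ge0 (#|` E|%:R))) le2.
have {}le4 := ler_wpM2l (mulr_ge0 (ler0n R k) (ler0n R #|` E|)) le4.
lra.
Qed.

End Energy.

(** * Sets of small perimeter *)

Section Perimeter.
Context {R : realType} {G : groupType}.
Implicit Types (U S F E H D Y : {fset G}) (g : G).

(** The part of the boundary of [D] visible inside [U]. For the sets [D] of [small_cut_superset] it
    is controlled by [U] alone, however large [D] is. *)
Definition cut U D g : R :=
  \sum_(y <- U) [&& y \in D, (g * y)%g \in U & (g * y)%g \notin D]%:R.

Lemma cut_ge0 U D g : 0 <= cut U D g.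
Proof. exact: sumr_ge0. Qed.

Lemma cutV U D g : cut U D g^-1 =
  \sum_(y <- U) [&& y \notin D, (g * y)%g \in U & (g * y)%g \in D]%:R.
Proof.
pose phi z : R := ((z \in D) && ((g^-1 * z)%g \notin D))%:R.
transitivity (\sum_(z <- U) ((g^-1 * z)%g \in U)%:R * phi z).
  apply: eq_bigr => z _; rewrite /phi.
  by case: (_ \in D); case: (_ \in U); case: (_ \in D); rewrite /= ?mulr0 ?mulr1 ?mul0r.
rewrite -(reindex_fset U U phi (mulKg g) (mulVKg g)).
apply: eq_bigr => z _; rewrite /phi mulKg.
by case: (_ \in D); case: (_ \in U); case: (_ \in D); rewrite /= ?mulr0 ?mulr1 ?mul0r.
Qed.

(** [D] nearly minimizes the perimeter among the supersets of [Q] and is compared with its union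
    with [U]. By submodularity, adding [U] removes the part of the boundary of [D] inside [U] and
    creates at most the boundary of [U]. *)
Lemma small_cut_superset (W : seq G) Q : exists2 D, (Q `<=` D)%fset &
  forall U, \sum_(w <- W) cut U D w <= \sum_(w <- W) exits U w + 1.
Proof.
have [D0 D0_min] : exists D0, forall D1,
    \sum_(w <- W) exits (Q `|` D0)%fset w <= \sum_(w <- W) exits (Q `|` D1)%fset w + 1 :> R.
  apply: (near_min fset0) => D; apply: sumr_ge0 => w _; exact: exits_ge0.
exists (Q `|` D0)%fset; first exact: fsubsetUl.
move=> U; have := D0_min (D0 `|` U)%fset; rewrite fsetUA.
set D := (Q `|` D0)%fset => D_min.
suff : \sum_(w <- W) exits (D `|` U)%fset w + \sum_(w <- W) cut U D w <=
    \sum_(w <- W) exits D w + \sum_(w <- W) exits U w :> R by lra.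
rewrite -!big_split /=; apply: ler_sum => w _.
have DB : (D `<=` D `|` U)%fset by exact: fsubsetUl.
have UB : (U `<=` D `|` U)%fset by exact: fsubsetUr.
clearbody D.
rewrite /exits /cut (sum_sub _ DB) (sum_sub _ UB) (sum_sub _ UB) -!big_split /=.
rewrite big_seq [leRHS]big_seq; apply: ler_sum => y.
rewrite !in_fsetU.
case: (y \in D); case: (y \in U); case: (_ \in D); case: (_ \in U);
  rewrite /= ?mulr0 ?mulr1 ?mul0r ?addr0 ?add0r //; lra.
Qed.

(** For each [e], the sums of [v] over [U] and over [e * U] differ only near the boundary of [U].
    This turns control of window averages into control of plain sums. *)
Lemma avg_on U E (v : G -> R) : (forall y, `|v y| <= 1) ->
  `|#|` E|%:R * \sum_(y <- U) v y - \sum_(h <- U) \sum_(e <- E) v (e * h)%g|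
  <= \sum_(e <- E) (exits U e + exits U e^-1).
Proof.
move=> v1; rewrite exchange_big /= -[#|` E|%:R]sum1_fset mulr_suml -sumrB.
apply: le_trans (ler_norm_sum _ _ _) _; apply: ler_sum => e _; rewrite mul1r.
have -> : \sum_(h <- U) v (e * h)%g = \sum_(h <- U) ((e * h)%g \in U)%:R * v (e * h)%g
    + \sum_(h <- U) ((e * h)%g \notin U)%:R * v (e * h)%g.
  rewrite -big_split/=; apply: eq_bigr => h _.
  by case: (_ \in U); rewrite /= ?mul1r ?mul0r ?addr0 ?add0r.
rewrite (reindex_fset _ _ _ (mulKg e) (mulVKg e)) opprD addrA -sumrB.
apply: le_trans (ler_normB _ _) _; rewrite [leRHS]addrC; apply: lerD.
  apply: le_trans (ler_norm_sum _ _ _) _; apply: ler_sum => h _.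
  case: (_ \in U); first by rewrite mul1r subrr normr0.
  by rewrite mul0r subr0.
apply: le_trans (ler_norm_sum _ _ _) _; apply: ler_sum => h _.
by rewrite normrM ger0_norm// ler_piMr.
Qed.

Lemma exitsI U D e : exits (U `&` D)%fset e <= exits U e + cut U D e.
Proof.
rewrite /exits /cut (sum_sub _ (fsubsetIl U D)) -big_split/=.
rewrite big_seq [leRHS]big_seq; apply: ler_sum => y yU.
rewrite !in_fsetI yU /=.
by case: (y \in D); case: (_ \in D); case: (_ \in U);
  rewrite /= ?mulr0 ?mulr1 ?mul0r ?addr0 ?add0r //; lra.
Qed.

Lemma exitsD U D e : exits (U `\` D)%fset e <= exits U e + cut U D e^-1.
Proof.
rewrite /exits cutV (sum_sub _ (fsubsetDl U D)) -big_split/=.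
rewrite big_seq [leRHS]big_seq; apply: ler_sum => y yU.
rewrite !in_fsetD yU /=.
by case: (y \in D); case: (_ \in D); case: (_ \in U);
  rewrite /= ?mulr0 ?mulr1 ?mul0r ?addr0 ?add0r //; lra.
Qed.

End Perimeter.

(** * Boundary and size of Folner sets *)

Section Folner.
Context {R : realType} {G : groupType}.
Variable F : nat -> {fset G}.
Hypothesis F_folner : folner R F.

Lemma card_folner_gt0 N : 0 < #|` F N|%:R :> R.
Proof. by rewrite ltr0n cardfs_gt0; case: F_folner. Qed.

Lemma folner_exits g (e : R) : 0 < e -> \forall N \near \oo, exits (F N) g <= e * #|` F N|%:R.
Proof.
move=> e0; case: F_folner => _ /(_ g) /cvgrPdist_le /(_ _ e0).
apply: filterS => N; rewrite sub0r normrN ger0_norm ?divr_ge0//.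
rewrite ler_pdivrMr ?card_folner_gt0//; apply: le_trans.
rewrite -sum1_fset; set V := fset_symdiff _ _.
have := @sum_ind_le R G (F N) V _ _ (fun=> 1) (mulKg g) (mulVKg g) (fun=> ler01).
apply: le_trans; rewrite /exits big_seq [leRHS]big_seq; apply: ler_sum => y yF.
rewrite mulr1 /V /fset_symdiff !in_fsetU !in_fsetD.
have -> : (g * y)%g \in fset_translate g (F N) by apply/imfsetP; exists y.
by case: (_ \in F N).
Qed.

Lemma sum_folner_exits (W : seq G) (e : R) : 0 < e ->
  \forall N \near \oo, \sum_(w <- W) exits (F N) w <= e * #|` F N|%:R.
Proof.
elim: W e => [|w W IHW] e e0.
  by near=> N; rewrite big_nil mulr_ge0// ltW.
have e2 : 0 < e / 2 by lra.
apply: filterS2 (IHW _ e2) (folner_exits w e2) => N.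
rewrite big_cons; lra.
Unshelve. all: by end_near. Qed.

(** If [F N] has fewer than [n] elements and its total boundary under [P] is below one point, no
    point leaves it. It then contains a translate of [P], which has at least [n] elements. *)
Lemma folner_card (C : R) : infinite_set [set: G] ->
  \forall N \near \oo, C <= #|` F N|%:R.
Proof.
move=> Ginf.
have [n Cn] : exists n : nat, C <= n%:R.
  exists (Num.truncn `|C|).+1.
  by rewrite (le_trans (ler_norm C))// ltW// truncnS_gt.
have [P _ Pn] := infinite_set_fset n Ginf.
have n0 : 0 < (n.+1%:R^-1 : R) by rewrite invr_gt0.
apply: filterS (sum_folner_exits P n0) => N small.
apply: (le_trans Cn); rewrite ler_nat leqNgt; apply/negP => Fn.
have lt1 : \sum_(w <- P) exits (F N) w < 1 :> R.
  apply: (le_lt_trans small); rewrite mulrC ltr_pdivrMr ?ltr0n// mul1r ltr_nat.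
  exact: (ltn_trans Fn).
have [y yF] := fset0Pn _ (F_folner.1 N).
suff : (#|` P| <= #|` F N|)%N by move=> /(leq_trans Pn); rewrite leqNgt Fn.
rewrite -(ler_nat R) -!sum1_fset.
have := @sum_ind_le R G P (F N) _ _ (fun=> 1) (mulgK y) (mulgVK y) (fun=> ler01).
apply: le_trans; rewrite big_seq [leRHS]big_seq; apply: ler_sum => g gP.
rewrite mulr1; have [//|gyF] := boolP (_ \in F N).
suff : 1 <= \sum_(w <- P) exits (F N) w :> R by rewrite leNgt lt1.
rewrite (big_rem _ gP)/= /exits (big_rem _ yF)/= gyF -addrA lerDl addr_ge0//.
  exact: sumr_ge0.
by apply: sumr_ge0 => w _; exact: sumr_ge0.
Qed.

End Folner.

(** * Gluing configurations of increasing quality *)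

Lemma le_sqr_half (R : realFieldType) (v r : R) :
  0 < r -> v <= (2 * r)^-1 * v ^+ 2 + r / 2.
Proof.
move=> r0; have r0' : r != 0 by rewrite gt_eqF.
rewrite -subr_ge0 (_ : _ - v = (v - r) ^+ 2 / (2 * r)); last by field.
by rewrite divr_ge0 ?sqr_ge0// mulr_ge0// ltW.
Qed.

(** In [glue_two_scales] the four booleans are [l * y \in F N], [l * y \in D0], [y \in D] and
    [l * y \in D]. *)
Lemma exceptional_ge1 (R : numDomainType) (b1 b2 b3 b4 : bool) : [|| ~~ b1, b2 | b3 != b4] ->
  1 <= (~~ b1)%:R + b2%:R + [&& b3, b1 & ~~ b4]%:R + [&& ~~ b3, b1 & b4]%:R :> R.
Proof. by rewrite -!natrD ler1n; case: b1; case: b2; case: b3; case: b4. Qed.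

Section Glue.
Context {R : realType} {G : groupType}.
Implicit Types (U S E H D Y Q : {fset G}) (g : G).
Variable F : nat -> {fset G}.
Hypothesis F_folner : folner R F.
Hypothesis G_infinite : infinite_set [set: G].
Variables (f : nat -> (G -> bool) -> G -> R) (win : nat -> seq G).
Hypothesis f_le1 : forall i x y, `|f i x y| <= 1.
Hypothesis f_loc : forall i x x' y,
  (forall l, l \in win i -> x (l * y)%g = x' (l * y)%g) -> f i x y = f i x' y.
Hypothesis f_sample : forall k (Z : seq G) (a : nat -> G -> R),
  exists x, \sum_(i < k) \sum_(y <- Z) a i y * f i x y <= 0.

Definition windows k : seq G := flatten [seq win i | i <- iota 0 k].

Lemma f_loc_windows k i x x' y : (i < k)%N ->
  (forall l, l \in windows k -> x (l * y)%g = x' (l * y)%g) -> f i x y = f i x' y.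
Proof.
move=> ik xx'; apply: f_loc => l lw; apply: xx'; apply/flattenP; exists (win i) => //.
by apply/mapP; exists i => //; rewrite mem_iota.
Qed.

(** [E] and [n0] come before [Q], and only the configuration depends on [Q]: the thresholds of all
    stages can be fixed before the sets to be filled are built. *)
Lemma uniformly_generic_at_scale k (eta : R) : 0 < eta -> exists E n0, E != fset0 /\
  forall Q, exists x, forall N i, (n0 <= N)%N -> (F N `<=` Q)%fset -> (i < k)%N ->
  \sum_(h <- F N) `|\sum_(e <- E) f i x (e * h)%g| <= eta * #|` E|%:R * #|` F N|%:R.
Proof.
move=> eta0; have := @f_loc_windows k; move: (windows k) => L f_locL; pose K : R := k.+1%:R.
have K0 : 0 < K by rewrite ltr0n.
(* Squared because the energy controls a mean of squares. The choices are made in the order [S]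
   (small boundary), [E] (large compared with [S]), [n0] (small boundary in all directions involving
   [E] and [L]). *)
pose eps := eta ^+ 2.
have eps0 : 0 < eps by rewrite exprn_gt0.
pose del := eps / (8 * K).
have del0 : 0 < del by rewrite divr_gt0// mulr_gt0.
have delE : 8 * K * del = eps by rewrite mulrC divfK// gt_eqF// mulr_gt0.
have kK : k%:R <= K by rewrite ler_nat.
have [N1 _ /(_ N1 (leqnn N1))] := sum_folner_exits F_folner (L ++ map (fun g => g^-1)%g L) del0.
rewrite big_cat /= big_map -big_split /=; set S := F N1 => small_S.
have S0 : S != fset0 := F_folner.1 N1.
have S0' : 0 < #|` S|%:R :> R by rewrite ltr0n cardfs_gt0.
have kapS : tile_loss L S <= del by rewrite /tile_loss ler_pdivrMr.
have [N2 _ /(_ N2 (leqnn N2))] := folner_card F_folner (#|` S|%:R / del) G_infinite.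
rewrite ler_pdivrMr//; set E := F N2 => big_E.
have E0 : E != fset0 := F_folner.1 N2.
have E1 : 1 <= #|` E|%:R :> R by rewrite ler1n cardfs_gt0.
pose W := E ++ L ++ flatten [seq [seq (l * e)^-1%g | e <- E] | l <- L].
have [n0 _ big_N] : \forall N \near \oo,
    (\sum_(w <- W) exits (F N) w <= del * #|` F N|%:R) /\ (4 / eps <= #|` F N|%:R).
  by apply: filterS2 (sum_folner_exits F_folner W del0) (folner_card F_folner (4 / eps) G_infinite).
exists E, n0; split=> // Q.
have [x xP] := @energy_near_minimizer R G k f L f_le1 f_locL (@f_sample k) S E Q S0.
exists x => N i n0N FQ ik.
have [] := big_N N n0N.
have {xP} := xP _ FQ.
set c := #|` F N|%:R; set energy := \sum_(h <- F N) _.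
rewrite ler_pdivrMr// /W !big_cat /= big_flatten big_map.
under [X in _ + (_ + X) <= _]eq_bigr do rewrite big_map.
set b1 := \sum_(e <- E) exits (F N) e; set b2 := \sum_(l <- L) exits (F N) l.
set b3 := \sum_(l <- L) _ => le_en small_bd c_big.
have c0 : 0 < c by exact: card_folner_gt0.
have b1_ge0 : 0 <= b1 by apply: sumr_ge0 => w _; exact: exits_ge0.
have b2_ge0 : 0 <= b2 by apply: sumr_ge0 => w _; exact: exits_ge0.
have b3_ge0 : 0 <= b3 by apply: sumr_ge0 => l _; apply: sumr_ge0 => w _; exact: exits_ge0.
set q := #|` E|%:R in E1 le_en big_E *; set s := #|` S|%:R in le_en big_E S0'.
(* The slack, the energy of the tiles, the points lost in tiling and the boundary terms each take at
   most a quarter of the bound. *)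
have energy_le : energy <= eps * q ^+ 2 * c.
  have q2 : q <= q ^+ 2 by rewrite expr2 ler_peMl// (le_trans ler01).
  have q21 : 1 <= q ^+ 2 by rewrite (le_trans E1).
  have h1 : 1 <= eps / 4 * q ^+ 2 * c.
    have : 1 <= eps / 4 * c by lra.
    by move=> h; rewrite mulrAC (le_trans h)// ler_peMr// (le_trans ler01).
  have h2 : k%:R * s * q * c <= (eps / 8) * q ^+ 2 * c.
    rewrite ler_pM2r// expr2 mulrA ler_pM2r ?(lt_le_trans ltr01)//.
    apply: (@le_trans _ _ (K * (q * del))); first exact: ler_pM.
    by rewrite -delE; lra.
  have h3 : k%:R * q * (q * (tile_loss L S * c)) <= (eps / 8) * q ^+ 2 * c.
    have -> : k%:R * q * (q * (tile_loss L S * c)) = k%:R * tile_loss L S * (q ^+ 2 * c) by ring.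
    rewrite -[leRHS]mulrA ler_pM2r ?mulr_gt0// ?(lt_le_trans ltr01)//.
    apply: (@le_trans _ _ (K * tile_loss L S)).
      rewrite ler_wpM2r// /tile_loss divr_ge0// sumr_ge0// => l _.
      by rewrite addr_ge0// exits_ge0.
    have := ler_wpM2l (ltW K0) kapS; lra.
  have h4 : k%:R * q ^+ 2 * (b1 + b2 + b3) <= (eps / 8) * q ^+ 2 * c.
    apply: (@le_trans _ _ (K * q ^+ 2 * (del * c))).
      apply: ler_pM; rewrite ?mulr_ge0 ?addr_ge0 ?sqr_ge0//; last by rewrite -addrA.
      by rewrite ler_wpM2r// sqr_ge0.
    by rewrite -delE; lra.
  have h5 : k%:R * q * b1 <= k%:R * q ^+ 2 * b1.
    by rewrite ler_wpM2r// ler_wpM2l.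
  have h6 : 0 <= k%:R * q ^+ 2 * b3 by rewrite !mulr_ge0// sqr_ge0.
  have : 0 <= k%:R * q ^+ 2 * b1 by rewrite !mulr_ge0// sqr_ge0.
  have : 0 <= k%:R * q ^+ 2 * b2 by rewrite !mulr_ge0// sqr_ge0.
  have e3 : k%:R * q * (q * b2) = k%:R * q ^+ 2 * b2 by ring.
  rewrite !mulrDr e3 in le_en; rewrite !mulrDr in h4.
  lra.
pose v h := \sum_(e <- E) f i x (e * h)%g.
have v2_le : \sum_(h <- F N) v h ^+ 2 <= eps * q ^+ 2 * c.
  apply: le_trans energy_le; apply: ler_sum => h _.
  rewrite (bigD1 (Ordinal ik)) //= lerDl sumr_ge0// => j _; exact: sqr_ge0.
(* [le_sqr_half] is applied with [r = eta * q] to pass from squares to absolute values. *)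
have etaq : 0 < eta * q by rewrite mulr_gt0// (lt_le_trans ltr01).
have v_le h : `|v h| <= (2 * (eta * q))^-1 * v h ^+ 2 + eta * q / 2.
  rewrite -[v h ^+ 2]real_normK ?num_real//; exact: (le_sqr_half `|v h| etaq).
apply: (@le_trans _ _ (\sum_(h <- F N)
    ((2 * (eta * q))^-1 * v h ^+ 2 + eta * q / 2))); first by apply: ler_sum => h _; exact: v_le.
rewrite big_split /= -mulr_sumr.
have -> : \sum_(h <- F N) eta * q / 2 = eta * q / 2 * c.
  by rewrite /c -sum1_fset mulr_sumr; apply: eq_bigr => h _; rewrite mulr1.
have : (2 * (eta * q))^-1 * (\sum_(h <- F N) v h ^+ 2) <= eta * q / 2 * c.
  rewrite ler_pdivrMl ?mulr_gt0// ?(lt_le_trans ltr01)//; rewrite (le_trans v2_le)// /eps.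
  by rewrite le_eqVlt; apply/orP; left; apply/eqP; field.
lra.
Qed.

(** The sum is split along [D]. Each part of [F N] has small boundary, so the window averages of
    [x0], respectively [x1], control its sum; replacing [x] by them is wrong only at the few points
    whose window leaves [F N], meets [D0] or straddles [D]. *)
Lemma glue_two_scales k (W0 : seq G) (eta : R) N D0 D E E' x0 x1 x i :
  (i < k)%N -> E != fset0 -> E' != fset0 ->
  W0 = windows k ++ E ++ E' ->
  \sum_(w <- W0) (exits (F N) w + exits (F N) w^-1) <= eta * #|` F N|%:R ->
  \sum_(w <- W0) (cut (F N) D w + cut (F N) D w^-1) <= eta * #|` F N|%:R ->
  (size (windows k))%:R * #|` D0|%:R <= eta * #|` F N|%:R ->
  (forall y, y \in F N -> y \in D -> y \notin D0 -> x y = x0 y) ->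
  (forall y, y \in F N -> y \notin D -> x y = x1 y) ->
  \sum_(h <- F N) `|\sum_(e <- E) f i x0 (e * h)%g| <= eta * #|` E|%:R * #|` F N|%:R ->
  \sum_(h <- F N) `|\sum_(e <- E') f i x1 (e * h)%g| <= eta * #|` E'|%:R * #|` F N|%:R ->
  `|\sum_(y <- F N) f i x y| <= 8 * eta * #|` F N|%:R.
Proof.
move=> ik E0 E'0 ->; have f_locL := @f_loc_windows k.
move: (windows k) f_locL => L f_locL.
set c := #|` F N|%:R; rewrite !big_cat /=.
set bL := \sum_(w <- L) (exits _ _ + _); set bE := \sum_(w <- E) (exits _ _ + _).
set bE' := \sum_(w <- E') (exits _ _ + _).
set cL := \sum_(w <- L) (cut _ _ _ + _); set cE := \sum_(w <- E) (cut _ _ _ + _).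
set cE' := \sum_(w <- E') (cut _ _ _ + _).
have bd2_ge0 (s : seq G) : 0 <= \sum_(w <- s) (exits (F N) w + exits (F N) w^-1) :> R.
  by apply: sumr_ge0 => w _; rewrite addr_ge0// exits_ge0.
have cut2_ge0 (s : seq G) : 0 <= \sum_(w <- s) (cut (F N) D w + cut (F N) D w^-1) :> R.
  by apply: sumr_ge0 => w _; rewrite addr_ge0// cut_ge0.
have bL0 : 0 <= bL := bd2_ge0 _; have bE0 : 0 <= bE := bd2_ge0 _.
have bE'0 : 0 <= bE' := bd2_ge0 _.
have cL0 : 0 <= cL := cut2_ge0 _; have cE0 : 0 <= cE := cut2_ge0 _.
have cE'0 : 0 <= cE' := cut2_ge0 _.
move=> small_bd small_cut small_D0 xx0 xx1 good0 good1.
have part (U E1 : {fset G}) (z : G -> bool) (b : R) : E1 != fset0 -> (U `<=` F N)%fset ->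
    \sum_(e <- E1) (exits U e + exits U e^-1) <= b -> 0 <= b ->
    \sum_(h <- F N) `|\sum_(e <- E1) f i z (e * h)%g| <= eta * #|` E1|%:R * c ->
    `|\sum_(y <- U) f i z y| <= eta * c + b.
  move=> E10 UF bdU b0 good.
  have E1_gt0 : 0 < #|` E1|%:R :> R by rewrite ltr0n cardfs_gt0.
  have E1_ge1 : 1 <= #|` E1|%:R :> R by rewrite ler1n cardfs_gt0.
  have := @avg_on R G U E1 (f i z) (fun y => f_le1 _ _ _).
  set X := \sum_(y <- U) f i z y; set Z := \sum_(h <- U) \sum_(e <- E1) _ => le_avg.
  have le_Z : `|Z| <= eta * #|` E1|%:R * c.
    apply: le_trans (ler_norm_sum _ _ _) _; apply: le_trans good.
    by rewrite (sum_sub _ UF); apply: ler_sum => h _; rewrite ler_piMl// ind_le1.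
  have : `|#|` E1|%:R * X| <= `|Z| + b.
    rewrite -[#|` E1|%:R * X](subrK Z) addrC (le_trans (ler_normD _ _))// lerD2l.
    exact: le_trans le_avg bdU.
  rewrite normrM gtr0_norm// => le_X.
  rewrite -(ler_pM2l E1_gt0) mulrDr.
  have : b <= #|` E1|%:R * b by rewrite ler_peMl.
  lra.
have part0 := part (F N `&` D)%fset E x0 (bE + cE) E0 (fsubsetIl _ _).
have part1 := part (F N `\` D)%fset E' x1 (bE' + cE') E'0 (fsubsetDl _ _).
have {}part0 : `|\sum_(y <- (F N `&` D)%fset) f i x0 y| <= eta * c + (bE + cE).
  apply: part0 => //; last exact: addr_ge0.
  rewrite /bE /cE -big_split /=; apply: ler_sum => e _.
  by have := exitsI (R := R) (F N) D e; have := exitsI (R := R) (F N) D e^-1; lra.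
have {}part1 : `|\sum_(y <- (F N `\` D)%fset) f i x1 y| <= eta * c + (bE' + cE').
  apply: part1 => //; last exact: addr_ge0.
  rewrite /bE' /cE' -big_split /=; apply: ler_sum => e _.
  have := exitsD (R := R) (F N) D e; have := exitsD (R := R) (F N) D e^-1.
  by rewrite invgK; lra.
pose exc y : R := \sum_(l <- L) (((l * y)%g \notin F N)%:R +
  ((l * y)%g \in D0)%:R +
  [&& y \in D, (l * y)%g \in F N & (l * y)%g \notin D]%:R +
  [&& y \notin D, (l * y)%g \in F N & (l * y)%g \in D]%:R).
have exc_le : \sum_(y <- F N) exc y <= bL + (size L)%:R * #|` D0|%:R + cL.
  rewrite /exc exchange_big /=.
  have -> : (size L)%:R * #|` D0|%:R = \sum_(l <- L) #|` D0|%:R :> R.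
    by rewrite -sum1_size natr_sum mulr_suml; apply: eq_bigr => l _; rewrite mul1r.
  rewrite /bL /cL -!big_split /=; apply: ler_sum => l _.
  rewrite !big_split /= cutV -/(exits (F N) l) -/(cut (F N) D l).
  have := @sum_ind_le R G (F N) D0 _ _ (fun=> 1) (mulKg l) (mulVKg l) (fun=> ler01).
  rewrite sum1_fset -mulr_suml mulr1.
  have := exits_ge0 (R := R) (F N) l^-1; lra.
have dom y : y \in F N -> `|f i x y - ((y \in D)%:R * f i x0 y + (y \notin D)%:R * f i x1 y)|
    <= 2 * exc y.
  move=> yF.
  have [/hasP[l lL bad]|/hasPn good] := boolP (has (fun l => [|| (l * y)%g \notin F N,
     (l * y)%g \in D0 | (y \in D) != ((l * y)%g \in D)]) L).
    have : 1 <= exc y.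
      rewrite /exc (big_rem _ lL) /=.
      rewrite -[leLHS]addr0; apply: lerD; last first.
        by apply: sumr_ge0 => ? _; rewrite !addr_ge0.
      exact: exceptional_ge1.
    have := f_le1 i x y; have := f_le1 i x0 y; have := f_le1 i x1 y.
    case: (y \in D) => /= h1 h2 h3 h4; rewrite mul0r mul1r ?addr0 ?add0r.
      by apply: le_trans (ler_normB _ _) _; lra.
    by apply: le_trans (ler_normB _ _) _; lra.
  rewrite (_ : f i x y = (y \in D)%:R * f i x0 y + (y \notin D)%:R * f i x1 y).
    rewrite subrr normr0 mulr_ge0//; apply: sumr_ge0 => l _; by rewrite !addr_ge0.
  have [yD|yD] /= := boolP (y \in D).
    rewrite mul1r mul0r addr0; apply: f_locL => // l lL.
    move: (good l lL); rewrite yD !negb_or !negbK => /and3P[lF lD0 /eqP lD].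
    exact: xx0.
  rewrite mul1r mul0r add0r; apply: f_locL => // l lL.
  move: (good l lL); rewrite (negbTE yD) !negb_or !negbK => /and3P[lF lD0 /eqP lD].
  by apply: xx1; rewrite -?lD.
have -> : \sum_(y <- F N) f i x y =
    \sum_(y <- F N) (f i x y - ((y \in D)%:R * f i x0 y + (y \notin D)%:R * f i x1 y)) +
    \sum_(y <- (F N `&` D)%fset) f i x0 y + \sum_(y <- (F N `\` D)%fset) f i x1 y.
  rewrite (sum_sub _ (fsubsetIl (F N) D)) (sum_sub _ (fsubsetDl (F N) D)) -!big_split /=.
  rewrite big_seq [RHS]big_seq; apply: eq_bigr => y yF.
  by rewrite in_fsetI in_fsetD yF /= andbT addrAC -addrA opprD; lra.
have le1 : `|\sum_(y <- F N) (f i x y - ((y \in D)%:R * f i x0 y + (y \notin D)%:R * f i x1 y))|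
    <= 2 * (bL + (size L)%:R * #|` D0|%:R + cL).
  apply: le_trans (ler_norm_sum _ _ _) _.
  apply: (@le_trans _ _ (\sum_(y <- F N) 2 * exc y)); last by rewrite -mulr_sumr ler_wpM2l.
  by rewrite big_seq [leRHS]big_seq; apply: ler_sum => y; exact: dom.
apply: le_trans (ler_normD _ _) _.
(* The boundary of [F N], the cut along [D], the set [D0] and the two window averages together
   contribute at most [2 * eta * c] each, whence the factor 8. *)
apply: (@le_trans _ _ (2 * (bL + (size L)%:R * #|` D0|%:R + cL) + (eta * c + (bE + cE))
  + (eta * c + (bE' + cE')))); last lra.
apply: lerD => //; apply: le_trans (ler_normD _ _) _; exact: lerD.
Qed.

Lemma exists_generic : exists x, forall i (e : R), 0 < e ->
  \forall N \near \oo, `|\sum_(y <- F N) f i x y| <= e * #|` F N|%:R.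
Proof.
pose eta k : R := k.+1%:R^-1.
have eta0 k : 0 < eta k by rewrite invr_gt0.
have /choice[w wP] : forall k, exists w : {fset G} * nat, w.1 != fset0 /\
    forall Q, exists x, forall N i, (w.2 <= N)%N -> (F N `<=` Q)%fset -> (i < k)%N ->
    \sum_(h <- F N) `|\sum_(e <- w.1) f i x (e * h)%g| <= eta k * #|` w.1|%:R * #|` F N|%:R.
  move=> k; have [E [n0 EP]] := uniformly_generic_at_scale k (eta0 k).
  by exists (E, n0).
pose E k := (w k).1.
pose W0 k := windows k ++ E k ++ E k.+1.
pose W k := W0 k ++ map (fun g => g^-1)%g (W0 k).
have sumW k (phi : G -> R) : \sum_(w <- W k) phi w = \sum_(w <- W0 k) (phi w + phi (w^-1)%g).
  by rewrite /W big_cat big_map big_split.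
(* A stage consists of a time [p.1] and the next set [p.2]. The time is found first, from [k] and
   [D0], so that the set can be made to contain all earlier [F N]; from that time on both scales [k]
   and [k.+1] are available. *)
pose step k D0 (p : nat * {fset G}) := [/\ (D0 `<=` p.2)%fset,
  forall N, (N < p.1)%N -> (F N `<=` p.2)%fset,
  forall U, \sum_(g <- W k) cut U p.2 g <= \sum_(g <- W k) exits U g + 1 :> R &
  forall N, (p.1 <= N)%N -> [/\ ((w k).2 <= N)%N, ((w k.+1).2 <= N)%N, (k <= N)%N,
    \sum_(g <- W k) exits (F N) g + 1 <= eta k * #|` F N|%:R &
    (size (windows k))%:R * #|` D0|%:R <= eta k * #|` F N|%:R]].
have /choice[st stP] : forall kD : nat * {fset G}, exists p, step kD.1 kD.2 p.
  move=> [k D0] /=.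
  have eta2 : 0 < eta k / 2 by rewrite divr_gt0.
  have [n1 _ n1P] := sum_folner_exits F_folner (W k) eta2.
  have [n2 _ n2P] := folner_card F_folner (2 / eta k) G_infinite.
  have [n3 _ n3P] := folner_card F_folner ((size (windows k))%:R * #|` D0|%:R / eta k) G_infinite.
  pose n := (\max_(m <- [:: n1; n2; n3; (w k).2; (w k.+1).2; k]) m)%N.
  have le_n N m : (n <= N)%N -> m \in [:: n1; n2; n3; (w k).2; (w k.+1).2; k] -> (m <= N)%N.
    by move=> nN mn; apply: leq_trans nN; exact: leq_bigmax_seq.
  have [D QD Dcut] := @small_cut_superset R G (W k) (D0 `|` \bigcup_(N <- iota 0 n) F N)%fset.
  exists (n, D); split => /=.
  - exact: fsubset_trans (fsubsetUl _ _) QD.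
  - move=> N Nn; apply: fsubset_trans QD; apply: fsubset_trans (fsubsetUr _ _).
    by apply: (bigfcup_sup (P := xpredT)) => //; rewrite mem_iota.
  - exact: Dcut.
  - move=> N nN; split; try by apply: (le_n _ _ nN); rewrite !inE eqxx ?orbT.
      have /n1P /= h1 : (n1 <= N)%N by apply: (le_n _ _ nN); rewrite !inE eqxx.
      have /n2P /= : (n2 <= N)%N by apply: (le_n _ _ nN); rewrite !inE eqxx ?orbT.
      by rewrite ler_pdivrMr//; lra.
    have /n3P /= : (n3 <= N)%N by apply: (le_n _ _ nN); rewrite !inE eqxx ?orbT.
    by rewrite ler_pdivrMr// [leRHS]mulrC.
(* The final configuration is [xs k] on [D k.+1] minus [D k].  The time [n k] comes
   after [D k], which is thus negligible in [F N] for [N >= n k], while [D k.+1]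
   contains [F N] for [N < n k]: each [F N] sees essentially two of the [xs]. *)
pose D := fix D k := if k is k'.+1 then (st (k', D k')).2 else fset0.
pose n k := (st (k, D k)).1.
have DP k : step k (D k) (n k, D k.+1).
  by have := stP (k, D k); rewrite /n /=; case: (st _).
have D_mono : forall j k, (j <= k)%N -> (D j `<=` D k)%fset.
  move=> j k /subnK <-; elim: (k - j)%N => [|m IHm]; first exact: fsubset_refl.
  by rewrite addSn; apply: fsubset_trans IHm _; have [] := DP (m + j)%N.
(* [xs k] serves as [x0] at stage [k] and as [x1] at stage [k - 1]; the sets [F N] of both stages
   lie in [D k.+2]. *)
have /choice[xs xsP] : forall k, exists x, forall N i, ((w k).2 <= N)%N ->
    (F N `<=` D k.+2)%fset -> (i < k)%N ->
    \sum_(h <- F N) `|\sum_(e <- E k) f i x (e * h)%g| <= eta k * #|` E k|%:R * #|` F N|%:R.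
  by move=> k; have [_ /(_ (D k.+2))] := wP k.
(* The first set of the chain containing [y] decides. The default value is immaterial, since every
   [F N] lies in some [D k]. *)
pose x y := if pselect (exists j, y \in D j.+1) is left ex then xs (ex_minn ex) y else false.
have xE k y : y \in D k.+1 -> y \notin D k -> x y = xs k y.
  move=> yD yD'; rewrite /x; case: pselect => [ex|[]]; last by exists k.
  case: ex_minnP => j yj j_min; congr (xs _ y); apply/eqP; rewrite eqn_leq j_min//=.
  by rewrite leqNgt; apply: contra yD' => jk; apply: (fsubsetP (D_mono _ _ jk)).
have stage k N i : (n k <= N)%N -> (N < n k.+1)%N -> (i < k)%N ->
    `|\sum_(y <- F N) f i x y| <= 8 * eta k * #|` F N|%:R.
  move=> nN Nn ik.
  have [_ _ Dcut /(_ N nN)[k1 k2 _ small_bd small_D]] := DP k.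
  have [_ FD _ _] := DP k.+1.
  have FD2 : (F N `<=` D k.+2)%fset by apply: FD.
  have eta_le : eta k.+1 <= eta k by rewrite lef_pV2 ?posrE// ler_nat.
  apply: (@glue_two_scales k (W0 k) (eta k) N (D k) (D k.+1)
    (E k) (E k.+1) (xs k) (xs k.+1)) => //.
  - by case: (wP k).
  - by case: (wP k.+1).
  - rewrite -(sumW k (fun w => exits (F N) w)) (le_trans _ small_bd)// lerDl//.
  - rewrite -(sumW k (fun w => cut (F N) (D k.+1) w)); exact: le_trans (Dcut _) small_bd.
  - by move=> y _ yD yD0; exact: xE.
  - by move=> y yF yD; apply: xE => //; exact: (fsubsetP FD2).
  - exact: xsP.
  - apply: le_trans (xsP k.+1 N i k2 _ (ltnW _)) _ => //.
      by apply: fsubset_trans FD2 _; apply: D_mono.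
    by rewrite -!mulrA ler_wpM2r// mulr_ge0.
exists x => i e e0.
have [m me] : exists m : nat, 8 * eta m <= e.
  exists (Num.truncn (8 / e)); rewrite ler_pdivrMr ?ltr0n// mulrC -ler_pdivrMr//.
  by rewrite ltW// truncnS_gt.
(* [m] gives the precision, and [i.+1] ensures that statistic [i] is among those treated. *)
pose k0 := maxn m i.+1.
exists (n k0) => // N /= n0N.
have n_ge k : (k <= n k)%N by have [_ _ _ /(_ _ (leqnn _))[]] := DP k.
have ex_stage : exists k, (n k <= N)%N by exists k0.
have bd_stage k : (n k <= N)%N -> (k <= N)%N by apply: leq_trans.
case: (ex_maxnP ex_stage bd_stage) => k nk k_max.
have k0k : (k0 <= k)%N by exact: k_max.
have Nn : (N < n k.+1)%N by rewrite ltnNge; apply/negP => /k_max; rewrite ltnn.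
apply: le_trans (stage k N i nk Nn _) _.
  by apply: leq_trans k0k; rewrite leq_max leqnn orbT.
rewrite ler_wpM2r// (le_trans _ me)// ler_wpM2l// lef_pV2 ?posrE// ler_nat ltnS.
by apply: leq_trans k0k; rewrite leq_max leqnn.
Qed.

End Glue.

(** * From an action to a subset of the group *)

(** Otherwise the function would exceed its mean everywhere; the difference, positive with integral
    zero, would vanish almost everywhere, against total mass 1. This yields the sampling hypothesis
    of the gluing construction. *)
Lemma exists_le_mean (R : realType) (d : measure_display) (X : measurableType d)
    (mu : probability X R) (s : seq (R * set X)) :
  (forall t, t \in s -> measurable t.2) ->
  exists p, \sum_(t <- s) t.1 * (\1_(t.2) p - fine (mu t.2)) <= 0.
Proof.
move=> ms; pose S p : R := \sum_(t <- s) t.1 * \1_(t.2) p.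
pose c : R := \sum_(t <- s) t.1 * fine (mu t.2).
have [iS intS] : mu.-integrable setT (EFin \o S) /\ (\int[mu]_p (S p)%:E = c%:E)%E.
  rewrite /S /c; elim: s ms {S c} => [_|t s IHs ms].
    under eq_integral do rewrite big_nil.
    rewrite big_nil integral0; split => //.
    by apply: (eq_integrable measurableT (cst 0%E)) => [p _|]; rewrite ?big_nil//=;
      [rewrite big_nil|exact: integrable0].
  have [|is_ ints] := IHs; first by move=> u us; apply: ms; rewrite inE us orbT.
  have mt : measurable t.2 by apply: ms; rewrite mem_head.
  have it : mu.-integrable setT (EFin \o (\1_(t.2) : X -> R)).
    exact: integrable_indic.
  have itt : mu.-integrable setT (fun p => (t.1%:E * (\1_(t.2) p)%:E)%E).
    exact: integrableZl.
  have E : EFin \o (fun p => \sum_(t0 <- t :: s) t0.1 * \1_(t0.2) p) =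
     (fun p => (t.1%:E * (\1_(t.2) p)%:E)%E) \+ (EFin \o (fun p => \sum_(t0 <- s) t0.1 * \1_(t0.2) p)).
    by apply/funext => p /=; rewrite big_cons EFinD EFinM.
  split; first by rewrite E; exact: integrableD.
  under eq_integral do rewrite big_cons EFinD EFinM.
  rewrite integralD// ints integralZl// integral_indic// setIT big_cons EFinD EFinM fineK//.
  exact: fin_num_measure.
have muT : mu [set: X] = 1%E := probability_setT mu.
apply/not_existsP => gt0.
have S_gt p : c < S p.
  rewrite ltNge; apply/negP => Sc; apply: (gt0 p).
  by under eq_bigr do rewrite mulrBr; rewrite sumrB subr_le0.
have i_c : mu.-integrable setT (EFin \o cst c) by exact: finite_measure_integrable_cst.
pose g p := ((S p)%:E - c%:E)%E.
have ig : mu.-integrable setT g by exact: integrableB.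
have intg : (\int[mu]_p `|g p| = 0)%E.
  transitivity (\int[mu]_p g p)%E.
    apply: eq_integral => p _; rewrite gee0_abs// /g -EFinB lee_fin subr_ge0.
    exact: ltW.
  rewrite integralB_EFin// intS integral_cst// [X in (_ * X)%E](_ : _ = 1%E); last exact: muT.
  by rewrite mule1 subee.
have := (ae_eq_integral_abs mu measurableT (measurable_int _ ig)).1 intg.
move=> [N [mN N0 sub]].
have NT : N = setT.
  apply/seteqP; split=> // p _; apply: sub => /= /(_ I) /eqP.
  by rewrite /g -EFinB eqe subr_eq0 gt_eqF// S_gt.
have := esym N0; rewrite NT [RHS](_ : _ = 1%E); last exact: muT.
move=> /eqP.
by rewrite eqe eq_sym oner_eq0.
Qed.

Lemma enum_countable (T : Type) (t0 : T) : countable [set: T] ->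
  exists s : nat -> T, forall t, exists i, s i = t.
Proof.
move=> /countable_injP[f finj].
exists (fun i => if pselect (exists t, f t = i) is left ex then projT1 (cid ex) else t0).
move=> t; exists (f t); case: pselect => [ex|[]]; last by exists t.
by case: cid => u /= /finj; rewrite !inE; apply.
Qed.

Lemma countable_seq (T : Type) : countable [set: T] -> countable [set: seq T].
Proof.
move=> /countable_injP[f finj]; apply/countable_injP.
exists (fun s => choice.pickle (map f s)) => s t _ _ /(pcan_inj choice.pickleK).
by apply: inj_map => x y /finj; apply; rewrite inE.
Qed.

Lemma countable_pair_bool (T : Type) : countable [set: T] -> countable [set: T * bool].
Proof.
move=> /countable_injP[f finj]; apply/countable_injP.
exists (fun p => choice.pickle (f p.1, p.2)) => -[x b] [y c] _ _ /(pcan_inj choice.pickleK)[/finj xy ->].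
by rewrite xy ?inE.
Qed.

(** * Cylinders as lists of constraints *)

Section Cylinders.
Context {G : groupType}.
Implicit Types (s : seq (G * bool)).

(** A pair [(g, e)] encodes the factor of a cylinder with translation [g] and exponent [e]. Lists
    allow induction and, for countable [G], an enumeration of all cylinders. *)
Definition agrees (x : G -> bool) s (y : G) :=
  all (fun q => x (q.1^-1 * y)%g == q.2) s.

Definition spec n (e : 'I_n -> bool) (g : 'I_n -> G) : seq (G * bool) :=
  [seq (g i, e i) | i <- enum 'I_n].

Lemma translate_cylinderE (A : set G) n (e : 'I_n -> bool) (g : 'I_n -> G) y :
  (y \in translate_cylinder A e g) = agrees (fun z => `[< A z >]) (spec e g) y.
Proof.
have imgE i : [set (g i * x)%g | x in A] y <-> A ((g i)^-1 * y)%g.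
  by split=> [[x Ax <-]|Ay]; [rewrite mulKg | exists ((g i)^-1 * y)%g; rewrite ?mulVKg].
rewrite /agrees /spec all_map; apply/idP/allP => [|h].
  rewrite inE => action_cyl i _ /=; have := action_cyl i I; rewrite /set_pow.
  case: (e i) => [/imgE ?|nAy]; first by rewrite asboolT.
  by rewrite asboolF// => /imgE.
rewrite inE => i _; have /= := h i (mem_enum _ _); rewrite /set_pow => /eqP.
by case: (e i) => [/asboolP /imgE|/asboolPn nAy /imgE].
Qed.

Variables (X : Type) (T : G -> X -> X) (B : set X).

Definition action_cyl s : set X := [set p | all (fun q => `[< B (T q.1^-1 p) >] == q.2) s].

Hypothesis T1 : T 1%g = id.
Hypothesis TM : forall g h, T (g * h)%g = T g \o T h.

Lemma action_image g : T g @` B = T g^-1 @^-1` B.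
Proof.
apply/seteqP; split => [_ [p Bp <-]|p Bp].
  by rewrite /preimage /= -[T _ (T _ p)]/((T g^-1 \o T g) p) -TM mulVg T1.
by exists (T g^-1 p) => //; rewrite -[T _ (T _ p)]/((T g \o T g^-1) p) -TM mulgV T1.
Qed.

Lemma action_cylinderE n (e : 'I_n -> bool) (g : 'I_n -> G) :
  action_cylinder T B e g = action_cyl (spec e g).
Proof.
apply/seteqP; split => p.
  move=> h; rewrite /action_cyl /= /spec all_map; apply/allP => i _ /=.
  have := h i I; rewrite action_image /set_pow.
  by case: (e i) => /= ?; [rewrite asboolT | rewrite asboolF].
rewrite /action_cyl /= /spec all_map => /allP h i _.
have /= := h i (mem_enum _ _); rewrite action_image /set_pow => /eqP.
by case: (e i) => [/asboolP|/asboolPn].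
Qed.

Lemma action_cyl_cons q s : action_cyl (q :: s) = set_pow (T q.1^-1 @^-1` B) q.2 `&` action_cyl s.
Proof.
apply/seteqP; split => p; rewrite /action_cyl /=.
  move=> /andP[/eqP qp sp]; split => //; move: qp.
  by rewrite /set_pow; case: (q.2) => [/asboolP|/asboolPn].
move=> [qp sp]; apply/andP; split => //; move: qp.
by rewrite /set_pow; case: (q.2) => ?; [rewrite asboolT | rewrite asboolF].
Qed.

End Cylinders.

Lemma folner_ratioE (R : realType) (G : groupType) (F : nat -> {fset G}) (E : set G) N :
  folner_ratio R F E N = (\sum_(y <- F N) (y \in E)%:R) / #|` F N|%:R.
Proof.
rewrite /folner_ratio; congr (_ / _).
rewrite -sum1_fset big_fset /= -big_ind_seq.
by apply: eq_bigr => y _; rewrite mulr1.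
Qed.

(** * Densities realizing a given action *)

Section PartA.
Context {R : realType} {G : groupType}.
Variable F : nat -> {fset G}.
Hypothesis F_folner : folner R F.
Hypothesis G_countable : countable [set: G].
Hypothesis G_infinite : infinite_set [set: G].

Lemma density_of_action (d : measure_display) (X : measurableType d) (mu : probability X R)
      (T : G -> X -> X) (B : set X) :
    measure_preserving_action mu T -> measurable B ->
    exists A : set G,
      forall (n : nat) (e : 'I_n -> bool) (g : 'I_n -> G),
        has_density R F (translate_cylinder A e g) /\
        (density R F (translate_cylinder A e g))%:E
          = mu (action_cylinder T B e g).
Proof.
move=> [T1 TM Tmp] mB.
have [sq sqP] := @enum_countable (seq (G * bool)) [::]
  (countable_seq (countable_pair_bool G_countable)).
pose C s := action_cyl T B s.
have mT g E : measurable E -> measurable (T g @^-1` E).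
  by move=> mE; rewrite -[_ @^-1` _]setTI; apply: (Tmp g).1.
have mC s : measurable (C s).
  elim: s => [|q s IHs]; first by rewrite (_ : C [::] = setT)//; apply/seteqP; split.
  rewrite /C action_cyl_cons; apply: measurableI => //.
  by rewrite /set_pow; case: q.2; [|apply: measurableC]; apply: mT.
pose nu s : R := fine (mu (C s)).
have nuE s : (nu s)%:E = mu (C s) by rewrite fineK// fin_num_measure.
have nu0 s : 0 <= nu s by rewrite -lee_fin nuE.
have nu1 s : nu s <= 1 by rewrite -lee_fin nuE probability_le1.
(* The average of [f i x] over [F N] is the ratio of the [i]-th cylinder minus the measure it must
   converge to. *)
pose f i x y : R := (agrees x (sq i) y)%:R - nu (sq i).
pose win i := [seq q.1^-1%g | q <- sq i].
have f_le1 i x y : `|f i x y| <= 1.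
  rewrite ler_norml /f; have := nu0 (sq i); have := nu1 (sq i).
  by case: (agrees _ _ _) => /= h1 h2; apply/andP; split; lra.
have f_loc i (x x' : G -> bool) y :
    (forall l, l \in win i -> x (l * y)%g = x' (l * y)%g) -> f i x y = f i x' y.
  move=> xx'; rewrite /f /agrees; congr (_%:R - _); congr nat_of_bool.
  by apply: eq_in_all => q qs /=; rewrite xx'//; apply/mapP; exists q.
have f_sample k (Z : seq G) (a : nat -> G -> R) :
    exists x, \sum_(i < k) \sum_(y <- Z) a i y * f i x y <= 0.
  pose s := [seq (a i y, T y @^-1` C (sq i)) | i <- index_iota 0 k, y <- Z].
  have [|p] := @exists_le_mean R d X mu s.
    by move=> _ /allpairsP[[i y] [_ _ ->]] /=; exact: mT.
  rewrite /s big_allpairs_dep big_mkord /= => le0.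
  (* Along the orbit of [p], the configuration agrees with a list at [y] exactly when [T y p] lies
     in its cylinder. Since [T y] preserves [mu], the centring constant is the mean. *)
  exists (fun y => `[< B (T y p) >]); rewrite (le_trans _ le0)//.
  apply: ler_sum => i _; apply: ler_sum => y _.
  rewrite (Tmp y).2// indicE (_ : (p \in T y @^-1` C (sq i)) =
    agrees (fun y => `[< B (T y p) >]) (sq i) y)//.
  have agE : agrees (fun y => `[< B (T y p) >]) (sq i) y =
      all (fun q => `[< B (T q.1^-1%g (T y p)) >] == q.2) (sq i).
    by apply: eq_all => q /=; rewrite TM.
  by rewrite agE; apply/idP/idP; rewrite inE.
have [x xP] := exists_generic F_folner G_infinite f_le1 f_loc f_sample.
exists [set y | x y] => n e g.
have [i si] := sqP (spec e g).
have cvg_nu : folner_ratio R F (translate_cylinder [set y | x y] e g) @ \oo --> nu (sq i).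
  apply/cvgrPdist_le => eps eps0; apply: filterS (xP i _ eps0) => N le_eps.
  have F0 := card_folner_gt0 F_folner N.
  rewrite distrC folner_ratioE.
  have -> : nu (sq i) = (\sum_(y <- F N) nu (sq i)) / #|` F N|%:R.
    apply/eqP; rewrite eq_sym -[X in _ / X]sum1_fset.
    rewrite (eq_bigr (fun=> nu (sq i) * 1)) => [|? _]; last by rewrite mulr1.
    by rewrite -mulr_sumr mulfK// sum1_fset gt_eqF.
  rewrite -mulrBl -sumrB normrM [X in _ * X]gtr0_norm ?invr_gt0// ler_pdivrMr//.
  apply: le_trans le_eps; rewrite le_eqVlt; apply/orP; left; apply/eqP.
  congr (`|_|); apply: eq_bigr => y _; rewrite translate_cylinderE /f si.
  congr (_%:R - _); congr nat_of_bool; apply: eq_all => q /=.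
  by rewrite asboolb.
split; first by apply/cvg_ex; exists (nu (sq i)).
rewrite /density (cvg_lim _ cvg_nu)//.
by rewrite nuE si action_cylinderE.
Qed.

End PartA.

(** * From a subset of the group to an action *)

Section Digits.
Context {R : realType} {Y : Type}.
Variables (m : set Y -> R) (x : Y -> nat -> bool).
Hypothesis m_ge0 : forall E, 0 <= m E.
Hypothesis mU : forall E E', E `&` E' = set0 -> m (E `|` E') = m E + m E'.
Hypothesis mT : m setT = 1.

Fixpoint rprefix (z : nat -> bool) n : seq bool :=
  if n is n'.+1 then z n' :: rprefix z n' else [::].

Lemma rprefixE z n : rprefix z n = rev (mkseq z n).
Proof. by elim: n => // n IHn; rewrite mkseqS rev_rcons /= IHn. Qed.

Let branch (w : seq bool) : set Y := [set y | rprefix (x y) (size w) = w].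
Let p w := m (branch w).

Let m0 : m set0 = 0.
Proof.
have := mU (setI0 set0); rewrite setU0 => /eqP.
by rewrite -subr_eq0 opprD addrA subrr sub0r oppr_eq0 => /eqP.
Qed.

Let branch_split w Q : branch w `&` Q =
  (branch (false :: w) `&` Q) `|` (branch (true :: w) `&` Q).
Proof.
apply/seteqP; split => [y [yw yQ]|y [|] [/= [_ yw] yQ]] //.
by case xy : (x y (size w)); [right|left]; split => //; rewrite /branch /= xy yw.
Qed.

Let m_split w Q : m (branch w `&` Q) =
  m (branch (false :: w) `&` Q) + m (branch (true :: w) `&` Q).
Proof.
rewrite branch_split mU//; apply/seteqP; split => // y [[/= [xy _] _] [[]]].
by rewrite xy.
Qed.

Let p_split w : p w = p (false :: w) + p (true :: w).
Proof. by have := m_split w setT; rewrite !setIT. Qed.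

(* Words are read backwards, the latest digit first: the interval of a word is
   cut by its last digit into two pieces of lengths [p (false :: w)] and
   [p (true :: w)]. *)
Let lo := fix lo w := if w is b :: w' then
  if b then lo w' + p (false :: w') else lo w' else 0.
Let loF w : lo (false :: w) = lo w. Proof. by []. Qed.
Let loT w : lo (true :: w) = lo w + p (false :: w). Proof. by []. Qed.
Let thr w := lo w + p (false :: w).
Let itv w : set R := `[lo w, lo w + p w[%classic.

Let pre := fix pre n (t : R) : seq bool :=
  if n is n'.+1 then (thr (pre n' t) <= t) :: pre n' t else [::].

Let preS n t : pre n.+1 t = (thr (pre n t) <= t) :: pre n t. Proof. by []. Qed.

Let itv_split w S : itv w `&` S = (itv (false :: w) `&` S) `|` (itv (true :: w) `&` S).
Proof.
have ps := p_split w; have p0 : 0 <= p (false :: w) := m_ge0 _.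
have p1 : 0 <= p (true :: w) := m_ge0 _.
apply/seteqP; split => [t [+ tS]|t [|] [+ tS]]; rewrite /itv /= !in_itv /= ?loF ?loT.
- move=> /andP[lot tlo]; have [le|lt] := leP (lo w + p (false :: w)) t.
    by right; split=> //; apply/andP; split=> //; lra.
  by left; split=> //; apply/andP; split.
- by move=> /andP[lot tlo]; split=> //; apply/andP; split=> //; lra.
- by move=> /andP[lot tlo]; split=> //; apply/andP; split=> //; lra.
Qed.

Let itv_sub b w : itv (b :: w) `<=` itv w.
Proof.
by move=> t bt; rewrite -[itv w]setIT itv_split; case: b bt => ?; [right|left].
Qed.

Let pre_itv w t : itv w t -> pre (size w) t = w.
Proof.
elim: w => // b w IHw bt; rewrite [size _]/= preS (IHw (itv_sub bt)); congr (_ :: _).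
move: bt; rewrite /itv /thr /= in_itv /=; case: b; rewrite ?loF ?loT => /andP[h1 h2]; first exact: h1.
by apply/negbTE; rewrite -ltNge.
Qed.

Let measurable_cstb (b : bool) : measurable [set _ : R | b].
Proof.
case: b; first by rewrite (_ : mkset _ = setT)//; apply/seteqP; split.
by rewrite (_ : mkset _ = set0)//; apply/seteqP; split.
Qed.

(** [Q] may depend on [t] for the sake of the induction: the latest digit, itself a condition on
    [t], is absorbed into [Q]. *)
Let measurable_pre n (Q : seq bool -> R -> bool) :
  (forall w, measurable [set t | Q w t]) -> measurable [set t | Q (pre n t) t].
Proof.
elim: n Q => [|n IHn] Q mQ; first exact: mQ.
apply: (IHn (fun w t => Q ((thr w <= t) :: w) t)) => w.
have -> : [set t | Q ((thr w <= t) :: w) t] =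
    (`[thr w, +oo[%classic `&` [set t | Q (true :: w) t]) `|`
    (`]-oo, thr w[%classic `&` [set t | Q (false :: w) t]).
  apply/seteqP; split => t /=; rewrite !in_itv/= andbT.
    by have [le|lt] := leP (thr w) t => ?; [left|right].
  by case=> [[->]//|[+ ?]]; rewrite ltNge => /negbTE ->.
by apply: measurableU; apply: measurableI.
Qed.

(** Both sides split along the next digit. With no digit left to split, each is zero or the mean of
    the branch, which is the length of its interval by construction. *)
Let measure_pre k w (Q : pred (seq bool)) :
  lebesgue_measure (itv w `&` [set t | Q (pre (k + size w) t)]) =
  (m (branch w `&` [set y | Q (rprefix (x y) (k + size w))]))%:E.
Proof.
elim: k w => [|k IHk] w.
  rewrite add0n.
  have [Qw|Qw] := boolP (Q w).
    have -> : itv w `&` [set t | Q (pre (size w) t)] = itv w.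
      by apply: setIidl => t /pre_itv /= ->.
    have -> : branch w `&` [set y | Q (rprefix (x y) (size w))] = branch w.
      by apply: setIidl => y /= ->.
    rewrite -/(p w) /itv lebesgue_measure_itv/= lte_fin ltrDl.
    have [p0|] := ltP 0 (p w); first by rewrite -EFinB addrC addKr.
    by rewrite le_eqVlt ltNge m_ge0 orbF => /eqP ->.
  rewrite (_ : _ `&` _ = set0); last first.
    by apply/seteqP; split => // t [/pre_itv /= ->]; exact/negP.
  rewrite (_ : _ `&` _ = set0) ?measure0 ?m0//.
  by apply/seteqP; split => // y [/= ->]; exact/negP.
have mpre n : measurable [set t | Q (pre n t)].
  apply: (@measurable_pre n (fun w _ => Q w)) => v.
  exact: measurable_cstb.
rewrite addSnnS m_split EFinD -!(IHk (_ :: w)) /= itv_split measureU//.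
- by apply: measurableI; [exact: measurable_itv|exact: mpre].
- by apply: measurableI; [exact: measurable_itv|exact: mpre].
apply/seteqP; split => // t [[/= t0 _] [t1 _]].
by have := pre_itv t0; rewrite (pre_itv t1).
Qed.

(** [m] is only finitely additive. Countable additivity is supplied by the uniform measure, of which
    only the masses of events on finitely many digits are prescribed. *)
Lemma exists_digits : exists phi : R -> nat -> bool,
  (forall n, measurable [set t | phi t n]) /\
  forall n (Q : pred (seq bool)),
    uniform_prob (@ltr01 R) [set t | Q (mkseq (phi t) n)] =
    (m [set y | Q (mkseq (x y) n)])%:E.
Proof.
pose phi t n := thr (pre n t) <= t.
have preE t n : pre n t = rprefix (phi t) n by elim: n => // n IHn; rewrite preS /= -IHn.
exists phi; split => [n|n Q].
  apply: (@measurable_pre n (fun w t => thr w <= t)) => w.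
  rewrite (_ : [set _ | _] = `[thr w, +oo[%classic); first exact: measurable_itv.
  by apply/seteqP; split => t /=; rewrite in_itv /= andbT.
have mkE z : mkseq z n = rev (rprefix z n) by rewrite rprefixE revK.
have branchT : branch [::] = setT by apply/seteqP; split.
have := measure_pre n [::] (Q \o rev); rewrite addn0 branchT setTI /=.
rewrite (_ : [set y | _] = [set y | Q (mkseq (x y) n)]); last first.
  by apply/seteqP; split=> y; rewrite /= mkE.
move=> <-.
pose E := [set t | Q (mkseq (phi t) n)].
have EE : E = [set t | Q (rev (pre n t))].
  by apply/seteqP; split=> t; rewrite /E /= mkE preE.
have mE : measurable E.
  rewrite EE; apply: (@measurable_pre n (fun w _ => Q (rev w))) => w.
  exact: measurable_cstb.
have p1 : p [::] = 1 by rewrite /p branchT.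
have : (\int[uniform_prob (@ltr01 R)]_t (\1_E t)%:E =
    (1 - 0)^-1%:E * \int[lebesgue_measure]_(t in `[0%R, 1%R]) (\1_E t)%:E)%E.
  apply: integral_uniform => [|t]; last by rewrite lee_fin.
  exact/measurable_EFinP/measurable_indicP.
rewrite !integral_indic// setIT subr0 invr1 mul1e => ->.
(* The intervals are half open, so the endpoint 1 is split off; it has measure zero. *)
have -> : E `&` `[0, 1] = (itv [::] `&` E) `|` (E `&` [set 1]).
  apply/seteqP; split => t; rewrite /itv /= !in_itv /= p1 add0r.
    move=> [Et /andP[t0 t1]]; have [lt1|] := ltP t 1; first by left; rewrite t0.
    by move=> ge1; right; split => //; apply/eqP; rewrite eq_le t1.
  move=> [[/andP[t0 t1] Et]|[Et t1]]; split => //; first by rewrite t0 ltW.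
  by rewrite t1 ler01 lexx.
rewrite measureU//; last 3 first.
- by apply: measurableI => //; exact: measurable_itv.
- exact: measurableI.
- apply/seteqP; split => // t [[+ _] [_ t1]].
  by rewrite /itv /= in_itv /= p1 add0r t1 ltxx andbF.
rewrite [X in (_ + X)%E](_ : _ = 0%E); first by rewrite adde0 EE.
apply/eqP; rewrite -measure_le0 -(lebesgue_measure_set1 (1 : R)).
apply: le_measure; rewrite ?inE; last exact: subIsetr.
  by apply: measurableI => //; exact: measurable_set1.
exact: measurable_set1.
Qed.

End Digits.

(** Compactness of the segment gives a cluster point, and an ultrafilter converges to each of its
    cluster points. *)
Lemma ultra_cvg (R : realType) (U : set_system nat) (u : nat -> R) (a b : R) :
  UltraFilter U -> (forall n, a <= u n <= b) -> exists l : R, u @ U --> l.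
Proof.
move=> Uultra u_ab.
have [|l [_ lclust]] := @segment_compact R a b (u @ U) _.
  suff : U (u @^-1` `[a, b]) by [].
  by apply: filterE => n /=; rewrite in_itv /=; exact: u_ab.
exists l => V lV; have [//|UV] := in_ultra_setVsetC (u @^-1` V) Uultra.
by have [t [nVt Vt]] := lclust (~` V) V UV lV.
Qed.

(** * The invariant mean *)

Section PartB.
Context {R : realType} {G : groupType}.
Variable F : nat -> {fset G}.
Hypothesis F_folner : folner R F.

Lemma ratio_itv (E : set G) N : 0 <= folner_ratio R F E N <= 1.
Proof.
rewrite folner_ratioE divr_ge0 ?sumr_ge0//=.
rewrite ler_pdivrMr ?(card_folner_gt0 F_folner)// mul1r -sum1_fset.
by apply: ler_sum => y _; exact: ind_le1.
Qed.

Lemma ratio_translate g (E : set G) :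
  (fun N => folner_ratio R F [set y | E (g * y)%g] N - folner_ratio R F E N) @ \oo --> (0 : R).
Proof.
apply/cvgrPdist_le => e e0.
apply: filterS (sum_folner_exits F_folner [:: g; g^-1%g] e0) => N.
rewrite big_cons big_seq1 sub0r normrN !folner_ratioE -mulrBl normrM.
have F0 := card_folner_gt0 F_folner N.
rewrite [X in _ * X <= _]gtr0_norm ?invr_gt0// ler_pdivrMr//; apply: le_trans.
have := @avg_on R G (F N) [fset g]%fset (fun y => (y \in E)%:R) _.
rewrite cardfs1 mul1r big_seq_fset1 distrC.
under eq_bigr do rewrite big_seq_fset1.
by apply=> y; rewrite ger0_norm// ind_le1.
Qed.

Lemma invariant_mean : exists m : set G -> R, [/\
  forall E, 0 <= m E,
  forall E E', E `&` E' = set0 -> m (E `|` E') = m E + m E',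
  m setT = 1,
  forall g (E : set G), m [set y | E (g * y)%g] = m E &
  forall E, has_density R F E -> m E = density R F E].
Proof.
have [U [Uultra sub]] := ultraFilterLemma (eventually_filter : ProperFilter \oo).
have /choice[m mP] : forall E, exists l : R, folner_ratio R F E @ U --> l.
  by move=> E; apply: (ultra_cvg Uultra); exact: ratio_itv.
have m_unique E l : folner_ratio R F E @ U --> l -> m E = l.
  by move=> El; exact: (cvg_unique _ (mP E) El).
exists m; split => [E|E E' EE'||g E|E dE].
- rewrite -(cvg_lim (@Rhausdorff R) (mP E)); apply: limr_ge.
    by apply/cvg_ex; exists (m E).
  by apply: filterE => N /=; have /andP[] := ratio_itv E N.
- apply: m_unique; rewrite (_ : folner_ratio R F (E `|` E') =
     folner_ratio R F E \+ folner_ratio R F E'); first exact: cvgD.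
  apply/funext => N; rewrite /= !folner_ratioE -mulrDl -big_split /=; congr (_ / _).
  apply: eq_bigr => y _; rewrite in_setU.
  have [yE|_] := boolP (y \in E); have [yE'|_] //= := boolP (y \in E'); rewrite ?addr0 ?add0r//.
  suff : (set0 : set G) y by [].
  by rewrite -EE'; split; exact: set_mem.
- apply: m_unique; rewrite (_ : folner_ratio R F setT = cst 1); first exact: cvg_cst.
  apply/funext => N; rewrite folner_ratioE (eq_bigr (fun=> 1)) ?sum1_fset.
    by rewrite divff// gt_eqF// card_folner_gt0.
  by move=> y _; rewrite in_setT.
- apply: m_unique; rewrite -[m E]add0r.
  rewrite (_ : folner_ratio R F _ = (fun N => folner_ratio R F [set y | E (g * y)%g] N -
     folner_ratio R F E N) \+ folner_ratio R F E); last first.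
    by apply/funext => N /=; rewrite subrK.
  by apply: cvgD => //; apply: cvg_trans (ratio_translate g E); exact: cvg_app.
- by apply: m_unique; apply: cvg_trans dE; exact: cvg_app.
Qed.

End PartB.

(** * The shift on configurations *)

Section Shift.
Context {G : groupType}.

Definition cylinder (s : seq (G * bool)) : set (G -> bool) :=
  [set w | all (fun q => w q.1 == q.2) s].

Definition cylinders : set (set (G -> bool)) := range cylinder.

Definition shift_space := g_sigma_algebraType cylinders.

Definition shift (h : G) (w : shift_space) : shift_space := fun g => w (h^-1 * g)%g.

Lemma shift1 : shift 1%g = id.
Proof. by apply/funext => w; apply/funext => g; rewrite /shift invg1 mul1g. Qed.

Lemma shiftM g h : shift (g * h)%g = shift g \o shift h.
Proof. by apply/funext => w; apply/funext => k; rewrite /shift /= invgM mulgA. Qed.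

Lemma shift_cylinder h s :
  shift h @^-1` cylinder s = cylinder [seq ((h^-1 * q.1)%g, q.2) | q <- s].
Proof. by apply/seteqP; split=> w; rewrite /cylinder /= all_map. Qed.

Lemma measurable_to_shift_space (d : measure_display) (X : measurableType d)
    (phi : X -> shift_space) :
  (forall g, measurable [set t | phi t g]) -> measurable_fun setT phi.
Proof.
move=> mphi; apply: (@measurability _ _ X shift_space setT phi cylinders) => //.
move=> _ [_ [s _ <-] <-]; rewrite setTI; elim: s => [|q s IHs].
  by rewrite (_ : _ @^-1` _ = setT)//; apply/seteqP; split.
have -> : phi @^-1` cylinder (q :: s) = set_pow [set t | phi t q.1] q.2 `&` (phi @^-1` cylinder s).
  apply/seteqP; split => t; rewrite /cylinder /set_pow /=.
    by move=> /andP[/eqP <- ?]; split=> //; case E : (phi t q.1) => /=; rewrite E.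
  case: q.2 => -[/= tq ts]; first by rewrite tq.
  by apply/andP; split => //; apply/eqP/negbTE/negP.
by apply: measurableI => //; rewrite /set_pow; case: q.2; [|apply: measurableC].
Qed.

Lemma measurable_coord (g : G) : measurable ([set w | w g] : set shift_space).
Proof.
apply: sub_sigma_algebra; exists [:: (g, true)] => //.
by apply/seteqP; split=> w; rewrite /cylinder /= andbT eqb_id.
Qed.

Lemma measurable_shift h : measurable_fun setT (shift h).
Proof. by apply: measurable_to_shift_space => g; exact: measurable_coord. Qed.

(** The cylinders form a pi-system that contains the whole space and generates the sigma-algebra. *)
Lemma cylinders_measure_unique (R : realType) (m1 m2 : probability shift_space R) :
  (forall s, m1 (cylinder s) = m2 (cylinder s)) ->
  forall C, measurable C -> m1 C = m2 C.
Proof.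
move=> m12 C mC; apply: (@measure_unique _ R shift_space cylinders (fun=> setT) _ _ _ _ m1 m2) => //.
- move=> _ _ [s _ <-] [t _ <-]; exists (s ++ t) => //.
  apply/seteqP; split=> w; rewrite /cylinder /= all_cat; first by move=> /andP.
  by move=> [-> ->].
- by move=> _; exists [::] => //; apply/seteqP; split.
- by apply/seteqP; split => // w _; exists 0%N.
- by move=> _ [s _ <-]; exact: m12.
- by move=> _; rewrite (le_lt_trans (probability_le1 m1 _))// ltry.
Qed.

End Shift.

(** * The shift-invariant measure attached to a set *)

Section PartB.
Context {R : realType} {G : groupType}.
Variable F : nat -> {fset G}.
Hypothesis F_folner : folner R F.
Hypothesis G_countable : countable [set: G].

Lemma mean_measure (m : set G -> R) (a : G -> bool) :
  (forall E, 0 <= m E) ->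
  (forall E E', E `&` E' = set0 -> m (E `|` E') = m E + m E') ->
  m setT = 1 ->
  exists mu : probability (@shift_space G) R,
    forall s, mu (cylinder s) = (m [set y | agrees a s y])%:E.
Proof.
move=> m_ge0 mU mT; have /countable_injP[f finj] := G_countable.
(* The digits of [y] list the values [a (g^-1 * y)] in the order given by [f]; indices outside the
   range of [f] get [false]. *)
pose x y j := if pselect (exists g, f g = j) is left ex
  then a ((projT1 (cid ex))^-1 * y)%g else false.
have xE y g : x y (f g) = a (g^-1 * y)%g.
  rewrite /x; case: pselect => [ex|[]]; last by exists g.
  by case: cid => h /= /finj ->; rewrite ?inE.
have [phi [mphi phiP]] := @exists_digits R G m x m_ge0 mU mT.
pose Phi (t : measurableTypeR R) : @shift_space G := fun g => phi t (f g).
have mPhi : measurable_fun setT Phi by apply: measurable_to_shift_space => g; exact: mphi.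
pose PhiM : {mfun measurableTypeR R >-> @shift_space G} := mfun_Sub (mem_set mPhi).
exists (distribution (uniform_prob (@ltr01 R)) PhiM) => s.
pose n := (\max_(q <- s) f q.1).+1.
have lt_n q : q \in s -> (f q.1 < n)%N.
  by move=> qs; rewrite ltnS; apply: leq_bigmax_seq.
pose Q v := all (fun q => nth false v (f q.1) == q.2) s.
have QE (z : nat -> bool) : Q (mkseq z n) = all (fun q => z (f q.1) == q.2) s.
  by apply: eq_in_all => q qs; rewrite nth_mkseq ?lt_n.
transitivity (uniform_prob (@ltr01 R) [set t | Q (mkseq (phi t) n)]).
  congr (uniform_prob _ _); apply/seteqP; split=> t; rewrite /= QE //.
have xs y : all (fun q => x y (f q.1) == q.2) s = agrees a s y.
  by apply: eq_all => q; rewrite xE.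
by rewrite phiP; congr (m _)%:E; apply/seteqP; split=> y; rewrite /= QE xs.
Qed.

Lemma action_of_set (A : set G) :
  exists (d : measure_display) (X : measurableType d) (mu : probability X R)
      (T : G -> X -> X) (B : set X),
      measure_preserving_action mu T /\ measurable B /\
      forall (n : nat) (e : 'I_n -> bool) (g : 'I_n -> G),
        has_density R F (translate_cylinder A e g) ->
        (density R F (translate_cylinder A e g))%:E
          = mu (action_cylinder T B e g).
Proof.
have [m [m_ge0 mU mT m_inv m_dens]] := invariant_mean F_folner.
pose a z := `[< A z >].
have [mu muE] := mean_measure a m_ge0 mU mT.
(* [B] reads the coordinate at 1, so its image under [shift g] reads the coordinate at [g]. *)
exists (sigma_display (@cylinders G)), (@shift_space G), mu, shift, [set w : @shift_space G | w 1%g].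
split; last split; [|exact: measurable_coord|].
  split; [exact: shift1|exact: shiftM|move=> h; split; first exact: measurable_shift].
  move=> C mC.
  pose hM : {mfun (@shift_space G) >-> (@shift_space G)} := mfun_Sub (mem_set (measurable_shift h)).
  apply: (@cylinders_measure_unique G R (distribution mu hM) mu) => // s.
  transitivity (mu (shift h @^-1` cylinder s)); first by [].
  (* Shifting amounts to replacing [y] by [h * y] in the constraints, which leaves the mean
     unchanged. *)
  rewrite shift_cylinder !muE -[RHS](congr1 EFin (m_inv h _)).
  have agE y : agrees a [seq ((h^-1 * q.1)%g, q.2) | q <- s] y = agrees a s (h * y)%g.
    by rewrite /agrees all_map; apply: eq_all => q; rewrite /= invgM invgK -mulgA.
  by congr (m _)%:E; apply/seteqP; split=> y; rewrite /= agE.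
move=> n e g /m_dens <-; rewrite (action_cylinderE _ shift1 shiftM).
rewrite (_ : action_cyl _ _ _ = cylinder (spec e g)).
  rewrite muE; congr (m _)%:E; apply/seteqP.
  by split=> y; rewrite /= /a -translate_cylinderE in_setE.
have csE w : all (fun q => `[< shift q.1^-1%g w 1%g >] == q.2) (spec e g) =
    all (fun q => w q.1 == q.2) (spec e g).
  by apply: eq_all => q; rewrite /shift invgK mulg1 asboolb.
by apply/seteqP; split=> w; rewrite /action_cyl /cylinder /= csE.
Qed.

End PartB.

Theorem theorem3p14 (R : realType) (G : groupType)
    (G_countable : countable [set: G]) (G_infinite : infinite_set [set: G])
    (G_amenable : amenable R G)
    (F : nat -> {fset G}) (F_folner : folner R F) :
  (forall (d : measure_display) (X : measurableType d) (mu : probability X R)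
      (T : G -> X -> X) (B : set X),
    measure_preserving_action mu T -> measurable B ->
    exists A : set G,
      forall (n : nat) (e : 'I_n -> bool) (g : 'I_n -> G),
        has_density R F (translate_cylinder A e g) /\
        (density R F (translate_cylinder A e g))%:E
          = mu (action_cylinder T B e g))
  /\
  (forall A : set G,
    exists (d : measure_display) (X : measurableType d) (mu : probability X R)
      (T : G -> X -> X) (B : set X),
      measure_preserving_action mu T /\ measurable B /\
      forall (n : nat) (e : 'I_n -> bool) (g : 'I_n -> G),
        has_density R F (translate_cylinder A e g) ->
        (density R F (translate_cylinder A e g))%:E
          = mu (action_cylinder T B e g)).
Proof.
split=> [d X mu T B Tmp mB|A].
  exact: (density_of_action F_folner G_countable G_infinite Tmp mB).
exact: (action_of_set F_folner G_countable).
Qed.
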